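(* Let $G$ be a subcubic graph. Then $\chi_p(D(G))\le 6$.
   Context: Graphs are finite and simple. A graph is subcubic if its maximum degree is at most $3$. The $1$-subdivision $D(G)$ of a graph $G$ is obtained from $G$ by replacing every edge with a path of two edges (i.e. inserting one new vertex of degree $2$ on each edge). The distance between two vertices is the number of edges of a shortest path between them (infinite if they lie in different components). For a non-decreasing sequence $S=(s_1,\ldots,s_k)$ of positive integers, a packing $S$-coloring of a graph $F$ is a partition of $V(F)$ into $V_1,\ldots,V_k$ (parts may be empty) such that for every $1\le i\le k$ and every pair of distinct vertices $u,v\in V_i$, the distance between $u$ and $v$ in $F$ is at least $s_i+1$. The packing chromatic number $\chi_p(F)$ is the smallest integer $k$ such that $F$ has a packing $(1,2,\ldots,k)$-coloring. *)

(* Defs.v *)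
From mathcomp Require Import all_boot.

Set Implicit Arguments.
Unset Strict Implicit.
Unset Printing Implicit Defensive.

Record sgraph := SGraph {
  vertex :> finType;
  adj : rel vertex;
  adj_sym : symmetric adj;
  adj_irr : irreflexive adj }.

Section Graph.
Variable G : sgraph.
Implicit Types u v : G.

Definition degree v := #|[set w | adj v w]|.
Definition max_degree := \max_(v : G) degree v.
Definition subcubic := max_degree <= 3.

Definition walk n u v :=
  [exists p : n.-tuple G, path (@adj G) u p && (last u p == v)].

Lemma connect_walk u v : connect (@adj G) u v -> exists n, walk n u v.
Proof.
case/connectP=> p p_path ->; exists (size p).
by apply/existsP; exists (in_tuple p); rewrite p_path eqxx.
Qed.

(* None stands for an infinite distance. *)
Definition dist u v : option nat :=
  if @idP (connect (@adj G) u v) is ReflectT uv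
  then Some (ex_minn (connect_walk uv)) else None.

Definition dist_ge u v n := if dist u v is Some d then n <= d else true.

(* The part V_(i+1) of the partition is the fibre of c over i : 'I_k. *)
Definition packing_coloring k (S : k.-tuple nat) (c : {ffun G -> 'I_k}) :=
  [forall u, forall v,
     (u != v) ==> (c u == c v) ==> dist_ge u v (tnth S (c u)).+1].

Definition packing_colorable k :=
  [exists c : {ffun G -> 'I_k}, packing_coloring [tuple i.+1 | i < k] c].

Lemma packing_colorable_ex : exists k, packing_colorable k.
Proof.
exists #|G|; apply/existsP; exists [ffun u => enum_rank u].
apply/forallP=> u; apply/forallP=> v; rewrite !ffunE.
by rewrite (inj_eq enum_rank_inj); case: eqP.
Qed.

Definition packing_chromatic_number := ex_minn packing_colorable_ex.

Definition edges : {set {set G}} :=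
  [set [set p.1; p.2] | p in [set p : G * G | adj p.1 p.2]].

Definition subdivision_vertex : finType := (G + {E | E \in edges})%type.

Definition subdivision_adj (a b : subdivision_vertex) :=
  match a, b with
  | inl x, inr E | inr E, inl x => x \in val E
  | _, _ => false
  end.

Lemma subdivision_sym : symmetric subdivision_adj.
Proof. by move=> [x|E] [y|F]. Qed.

Lemma subdivision_irr : irreflexive subdivision_adj.
Proof. by move=> [x|E]. Qed.

Definition subdivision : sgraph := SGraph subdivision_sym subdivision_irr.

End Graph.

(* Main.v *)
(* It suffices to colour G with two independent sets, two classes of vertices
   pairwise at distance at least 3 and one class of vertices pairwise at distance
   at least 4: distances double in D(G), whose subdivision vertices get colour 1.

   Fix a maximum cut c. The edges inside the two sides form a matching M, and for
   every set S at most half of the boundary edges of S lie in M, since otherwise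
   exchanging the sides of the vertices of S would improve the cut. Delete one
   end of every edge of M: what remains consists of two independent sets. Let R be
   the set of deleted vertices, and K the relation "at distance at most 2" on R.
   A nonempty subset of R of minimum degree at least 2 in K, together with the
   vertices that link it, is tight for the boundary condition. This forces its
   K-degrees to be exactly 2, so the minimal such subsets are disjoint, and
   removing one vertex from each leaves a K-forest, which two colours of distance
   at least 3 colour properly. The removed vertices receive the last colour. They
   can be chosen pairwise at distance at least 4: if R is chosen with a minimal
   number of vertices in such subsets, tightness shows that each vertex has at
   most one conflict with the other subsets, so that a greedy choice succeeds.

   The ends of the edges of M must be chosen so that no two vertices of R are at
   distance 2 only via a vertex covered by M. This is the 2-colouring of a union
   of two matchings, except near certain triangles, where an end of an edge of M
   directly receives the last colour. *)
Require Import Defs.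
From mathcomp Require Import all_boot.
From mathcomp Require Import all_order all_algebra zify.

Set Implicit Arguments.
Unset Strict Implicit.
Unset Printing Implicit Defensive.

Import Order.TTheory GRing.Theory Num.Theory.

(** * Colourings and transversals *)

Section Combinatorics.
Variable T : finType.
Implicit Types (A P S X : {set T}).

(** A union of two matchings has only even cycles. The induction deletes both ends of an edge of
    [n]. *)
Lemma two_matchings_bipartite A (m n : T -> T) :
    {in A, forall x, [/\ m x \in A, m x != x & m (m x) = x]} ->
    {in A, forall x, n x \in A -> n (n x) = x} ->
  exists g : T -> bool,
    {in A, forall x, g (m x) != g x} /\
    {in A, forall x, n x \in A -> n x != x -> g (n x) != g x}.
Proof.
elim: {A}_.+1 {-2}A (ltnSn #|A|) m => // k IH A; rewrite ltnS => leAk m mA nA.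
have [x /and3P[xA nxA nx]|noedge] :=
    pickP [pred x | [&& x \in A, n x \in A & n x != x]]; last first.
  (* No edge of [n] is left, so it suffices to separate the ends of each edge of [m], here by their
     rank. *)
  exists (fun x => enum_rank x < enum_rank (m x)); split=> x xA; last first.
    by move=> nxA nx; move: (noedge x); rewrite /= xA nxA nx.
  have [_ + ->] := mA x xA; rewrite -(inj_eq enum_rank_inj) -val_eqE /= neq_ltn.
  by case/orP=> lt; rewrite lt ltnNge ltnW.
have nnx := nA x xA nxA.
have [mxA mx mmx] := mA x xA; have [mnxA mnx mmnx] := mA _ nxA.
pose B := A :\ x :\ n x.
have ltB : #|B| < k.
  have := cardsD1 x A; have := cardsD1 (n x) (A :\ x); rewrite xA !inE nx nxA /=.
  by rewrite /B; lia.
have BA z : z \in B -> [/\ z \in A, z != x & z != n x].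
  by rewrite !inE => /and3P[].
have nB : {in B, forall z, n z \in B -> n (n z) = z}.
  by move=> z /BA[zA _ _] /BA[nzA _ _]; apply: nA.
have nBB z : z \in A -> z != x -> z != n x -> n z \in A -> n z \in B.
  move=> zA zx znx nzA; rewrite !inE nzA andbT; apply/andP; split.
    by apply: contra_neq zx => E; rewrite -(nA z zA nzA) E nnx.
  by apply: contra_neq znx => E; rewrite -(nA z zA nzA) E.
have [mE|mE] := eqVneq (m x) (n x).
  have mB : {in B, forall z, [/\ m z \in B, m z != z & m (m z) = z]}.
    move=> z /BA[zA zx znx]; have [mzA mz mmz] := mA z zA.
    split=> //; rewrite !inE mzA andbT; apply/andP; split.
      by apply: contra_neq zx => E; rewrite -mmz E -mE mmx.
    by apply: contra_neq znx => E; rewrite -mmz E mE.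
  have [g [gm gn]] := IH B ltB m mB nB.
  exists (fun z => if z == x then true else if z == n x then false else g z).
  split=> z zA.
    have [->|zx] := eqVneq z x; first by rewrite mE (negPf nx) eqxx.
    have [->|znx] := eqVneq z (n x); first by rewrite -{1}mE mmx eqxx.
    have zB : z \in B by rewrite !inE zx znx.
    have [/BA[_ /negPf-> /negPf->] _ _] := mB z zB; exact: gm.
  move=> nzA nz; have [->|zx] := eqVneq z x; first by rewrite (negPf nx) eqxx.
  have [->|znx] := eqVneq z (n x); first by rewrite nnx eqxx.
  have /BA[_ /negPf-> /negPf->] := nBB z zA zx znx nzA.
  by apply: gn => //; [rewrite !inE zx znx|apply: nBB].
(* The former partners of [x] and [n x] become matched. One edge replaces a path of three, so a
   colouring that differs at its ends extends alternately along the path. *)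
pose m' z := if z == m x then m (n x) else if z == m (n x) then m x else m z.
have mxmnx : m x != m (n x).
  by apply: contra_neq nx => E; rewrite -mmnx -E mmx.
have mnx_x : m (n x) != x by apply: contra_neq mE => E; rewrite -mmnx E.
have mxB : m x \in B by rewrite !inE mE mx.
have mnxB : m (n x) \in B by rewrite !inE mnx mnx_x.
have mB : {in B, forall z, [/\ m' z \in B, m' z != z & m' (m' z) = z]}.
  move=> z zB; have [zA zx znx] := BA z zB; rewrite /m'.
  have [->|z1] := eqVneq z (m x).
    by rewrite mnxB eq_sym (negPf mxmnx) eqxx.
  have [->|z2] := eqVneq z (m (n x)); first by rewrite eqxx.
  have [mzA mz mmz] := mA z zA.
  have mz1 : m z != m x by apply: contra_neq zx => E; rewrite -mmz E mmx.
  have mz2 : m z != m (n x) by apply: contra_neq znx => E; rewrite -mmz E mmnx.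
  rewrite (negPf mz1) (negPf mz2) mmz mz; split=> //.
  rewrite !inE mzA andbT; apply/andP; split.
    by apply: contra_neq z2 => E; rewrite -mmz E.
  by apply: contra_neq z1 => E; rewrite -mmz E.
have [g [gm gn]] := IH B ltB m' mB nB.
have gmm : g (m x) != g (m (n x)).
  by have := gm _ mxB; rewrite /m' eqxx eq_sym.
exists (fun z => if z == x then ~~ g (m x)
                 else if z == n x then ~~ g (m (n x)) else g z).
split=> z zA.
  have [->|zx] := eqVneq z x.
    by rewrite (negPf mx) (negPf mE); case: (g _).
  have [->|znx] := eqVneq z (n x).
    by rewrite (negPf mnx_x) (negPf mnx); case: (g _).
  have [mzA mz mmz] := mA z zA.
  have [E|mzx] := eqVneq (m z) x; first by rewrite -mmz E; case: (g _).
  have [E|mznx] := eqVneq (m z) (n x); first by rewrite -mmz E; case: (g _).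
  have zB : z \in B by rewrite !inE zx znx.
  have := gm z zB; rewrite /m'; have [E|_] := eqVneq z (m x).
    by move: mzx; rewrite E mmx eqxx.
  have [E|_] := eqVneq z (m (n x)); last by [].
  by move: mznx; rewrite E mmnx eqxx.
move=> nzA nz; have [->|zx] := eqVneq z x.
  by rewrite (negPf nx) eqxx; move: gmm; do 2 case: (g _).
have [->|znx] := eqVneq z (n x).
  by rewrite nnx eqxx; move: gmm; do 2 case: (g _).
have /BA[_ /negPf-> /negPf->] := nBB z zA zx znx nzA.
by apply: gn => //; [rewrite !inE zx znx|apply: nBB].
Qed.

Definition rdeg (K : rel T) v P := #|[set u in P | K v u]|.

Definition mindeg2 (K : rel T) P := [forall v in P, 1 < rdeg K v P].

(** Degrees can only grow in a union; hence every set has a greatest subset of this kind. *)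
Lemma mindeg2_bigcup (K : rel T) (F : pred {set T}) :
  (forall P, F P -> mindeg2 K P) -> mindeg2 K (\bigcup_(P | F P) P).
Proof.
move=> FK; apply/forall_inP=> v /bigcupP[P FP vP].
apply: leq_trans (forall_inP (FK P FP) v vP) _.
apply/subset_leq_card/subsetP=> u; rewrite !inE => /andP[uP ->].
by rewrite andbT; apply/bigcupP; exists P.
Qed.

(** Some vertex has at most one neighbour, and it can be coloured after all the others. *)
Lemma forest_two_colorable (K : rel T) A : symmetric K ->
    (forall P, P \subset A -> mindeg2 K P -> P = set0) ->
  exists g : T -> bool, {in A &, forall u v, u != v -> K u v -> g u != g v}.
Proof.
move=> Ksym; elim: {A}_.+1 {-2}A (ltnSn #|A|) => // k IH A; rewrite ltnS => leAk.
move=> AK; have [->|A0] := eqVneq A set0.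
  by exists xpredT => u v; rewrite inE.
have /forall_inPn[v vA] : ~~ mindeg2 K A.
  by apply: contra_neqN A0 => /AK ->.
rewrite -leqNgt => dv.
have [||g gP] := IH (A :\ v).
- by have := cardsD1 v A; rewrite vA; lia.
- by move=> P PA; apply: AK; apply: subset_trans PA (subsetDl _ _).
(* The only possible neighbour of [v] other than [v]. The default is reached when there is none, and
   any colour then suits [v]. *)
pose w := odflt v [pick u in A | K v u && (u != v)].
exists (fun u => if u == v then ~~ g w else g u) => x y xA yA xy Kxy.
have wE u : u \in A -> K v u -> u != v -> u = w.
  move=> uA Kvu uv; rewrite /w; case: pickP => [z /and3P[zA Kvz zv]|/(_ u)] /=.
    by apply: (card_le1_eqP dv); rewrite inE ?uA ?zA.
  by rewrite uA Kvu uv.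
have [xE|xv] := eqVneq x v; have [yE|yv] := eqVneq y v.
- by rewrite xE yE eqxx in xy.
- by rewrite -(wE y yA _ yv) -?xE //; case: (g y).
- by rewrite -(wE x xA _ xv); [case: (g x)|rewrite Ksym -yE].
by apply: gP; rewrite // !inE ?xv ?yv.
Qed.

(* Allowing one class of size one makes the greedy choice work: always choose next
   from the class that has just lost an element. *)
Lemma independent_transversal (ct : rel T) (I : finType) (J : {set I})
    (B : I -> {set T}) : symmetric ct -> irreflexive ct ->
    (forall s t u, ct s t -> ct s u -> t = u) ->
    {in J, forall i, B i != set0} ->
    {in J &, forall i j, #|B i| <= 1 -> #|B j| <= 1 -> i = j} ->
    {in J &, forall i j t, t \in B i -> t \in B j -> i = j} ->
  exists X, [/\ {in X, forall t, exists2 i, i \in J & t \in B i},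
    {in J, forall i, exists2 t, t \in X & t \in B i},
    {in J, forall i, {in X &, forall s t, s \in B i -> t \in B i -> s = t}} &
    {in X &, forall s t, ~~ ct s t}].
Proof.
move=> ctS ctI ctU; elim: {J}_.+1 {-2}J (ltnSn #|J|) B => // k IH J.
rewrite ltnS => leJk B B0 B1 BD.
have [J0|[i0 i0J]] := set_0Vmem J.
  by exists set0; split=> [t|i|i _ s t|s t]; rewrite ?J0 inE.
(* If some class has size at most one, [j] is that class; all the others have at least two
   elements. *)
have [j jJ jB] : exists2 j, j \in J & {in J, forall i, #|B i| <= 1 -> i = j}.
  have [j /andP[jJ j1]|no] := pickP [pred j in J | #|B j| <= 1].
    by exists j => // i iJ i1; apply: B1.
  by exists i0 => // i iJ i1; have := no i; rewrite /= iJ i1.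
have [s sj] := set0Pn _ (B0 j jJ).
pose B' i := B i :\: [set t | ct s t].
have B'B i t : t \in B' i -> t \in B i by rewrite inE => /andP[].
have cts : #|[set t | ct s t]| <= 1.
  by apply/card_le1_eqP=> t u; rewrite !inE => st su; apply: (ctU s).
have B'ge i : #|B i| <= #|B' i| + #|B i :&: [set t | ct s t]|.
  by have := cardsID [set t | ct s t] (B i); rewrite -/(B' i); lia.
have Bct i : #|B i :&: [set t | ct s t]| <= 1.
  exact: leq_trans (subset_leq_card (subsetIr _ _)) cts.
have B2 i : i \in J :\ j -> 1 < #|B i|.
  rewrite !inE => /andP[ij iJ]; rewrite ltnNge.
  by apply: contra_neqN ij => /(jB i iJ).
(* A class of size at most one after the removal has lost an element. As [s] conflicts with at most
   one element, there is at most one such class. *)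
have lost i : i \in J :\ j -> #|B' i| <= 1 -> exists2 t, t \in B i & ct s t.
  move=> iJ i1; have /set0Pn[t] : B i :&: [set t | ct s t] != set0.
    by rewrite -card_gt0; have := B'ge i; have := B2 i iJ; lia.
  by rewrite !inE => /andP[]; exists t.
have [||||X [XB BX X1 Xct]] := IH (J :\ j) _ B'.
- by have := cardsD1 j J; rewrite jJ; lia.
- move=> i iJ; rewrite -card_gt0.
  by have := B'ge i; have := B2 i iJ; have := Bct i; lia.
- move=> i l iJ lJ /(lost i iJ)[t ti cst] /(lost l lJ)[u ul csu].
  move: iJ lJ; rewrite !inE => /andP[_ iJ] /andP[_ lJ].
  by apply: (BD i l iJ lJ t) => //; rewrite (ctU _ _ _ cst csu).
- move=> i l; rewrite !inE => /andP[_ iJ] /andP[_ lJ] t /B'B ti /B'B tl.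
  exact: BD ti tl.
have Xj t : t \in X -> t \in B j -> False.
  move=> /XB[i iJj /B'B ti] tj; move: (iJj); rewrite !inE => /andP[ij iJ].
  by move: ij; rewrite (BD i j iJ jJ t ti tj) eqxx.
have Xs t : t \in X -> ct s t = false.
  by move=> /XB[i _]; rewrite !inE => /andP[/negPf].
have XB' i t : i \in J -> t \in X -> t \in B i -> (i \in J :\ j) /\ (t \in B' i).
  move=> iJ tX ti; have [l lJ tl] := XB t tX.
  have lJ' : l \in J by move: lJ; rewrite !inE => /andP[].
  by rewrite (BD i l iJ lJ' t ti (B'B _ _ tl)).
exists (s |: X); split=> [t|i iJ|i iJ t u|t u].
- rewrite !inE => /orP[/eqP->|/XB[i iJ /B'B ti]]; first by exists j.
  by exists i => //; move: iJ; rewrite !inE => /andP[].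
- have [->|ij] := eqVneq i j; first by exists s; rewrite ?setU11.
  have [|t tX /B'B ti] := BX i; first by rewrite !inE ij.
  by exists t; rewrite // !inE tX orbT.
- rewrite !inE => /orP[/eqP->|tX] /orP[/eqP->|uX] // ti ui.
  + by rewrite (BD i j iJ jJ s ti sj) in ui; case: (Xj u).
  + by rewrite (BD i j iJ jJ s ui sj) in ti; case: (Xj t).
  have [iJj ti'] := XB' i t iJ tX ti; have [_ ui'] := XB' i u iJ uX ui.
  exact: (X1 i iJj t u).
- rewrite !inE => /orP[/eqP->|tX] /orP[/eqP->|uX].
  + by rewrite ctI.
  + by rewrite Xs.
  + by rewrite ctS Xs.
  exact: Xct.
Qed.

End Combinatorics.

(** * The boundary inequality of a maximum cut *)

Section SignedCut.
Variables (T : finType) (e : rel T).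
Hypotheses (e_sym : symmetric e) (e_irr : irreflexive e).

Definition mono (c : T -> bool) x y := e x y && (c x == c y).
Definition bich (c : T -> bool) x y := e x y && (c x != c y).

Definition flip (c : T -> bool) (S : {set T}) x := c x (+) (x \in S).

(** A maximum cut, expressed as a minimum of the number of monochromatic ordered pairs. *)
Definition maxcut (c : T -> bool) :=
  forall c' : T -> bool, \sum_x \sum_y mono c x y <= \sum_x \sum_y mono c' x y.

Lemma maxcut_exists : exists c, maxcut c.
Proof.
pose w (c : {ffun T -> bool}) := \sum_x \sum_y mono c x y.
have [c _ cmin] := arg_minnP w (erefl : xpredT [ffun=> true]).
exists c => c'; apply: leq_trans (cmin [ffun x => c' x] isT) _.
by apply: eq_leq; apply: eq_bigr => x _; apply: eq_bigr => y _; rewrite /mono !ffunE.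
Qed.

Variable c : T -> bool.
Local Notation M := (mono c).
Local Notation N := (bich c).
Local Open Scope ring_scope.

Lemma mono_sym : symmetric M.
Proof. by move=> x y; rewrite /mono e_sym eq_sym. Qed.

Lemma bich_sym : symmetric N.
Proof. by move=> x y; rewrite /bich e_sym eq_sym. Qed.

Lemma edge_cases x y : e x y = M x y || N x y.
Proof. by rewrite /mono /bich; case: (e x y) => //=; case: (_ == _). Qed.

Lemma mono_bichF x y : M x y -> N x y = false.
Proof. by case/andP=> xy E; rewrite /bich xy E. Qed.

Definition edge_sign x y : int := (N x y)%:Z - (M x y)%:Z.
Definition signed_degree x (S : {set T}) : int := \sum_(y in S) edge_sign x y.
(** The number of monochromatic edges gained when the vertices of [S] change sides: on the boundary
    of [S], and only there, the two kinds of edges are exchanged. *)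
Definition signed_cut (S : {set T}) : int := \sum_(x in S) signed_degree x (~: S).

Lemma edge_sign_sym x y : edge_sign x y = edge_sign y x.
Proof. by rewrite /edge_sign bich_sym mono_sym. Qed.

Lemma edge_signxx x : edge_sign x x = 0.
Proof. by rewrite /edge_sign /bich /mono e_irr. Qed.

Lemma card_sum (P : pred T) (S : {set T}) :
  #|[set y in S | P y]|%:Z = \sum_(y in S) (P y)%:Z.
Proof.
rewrite -sum1_card (big_morph Posz PoszD (erefl _)) big_mkcond [RHS]big_mkcond.
by apply: eq_bigr => y _; rewrite !inE; case: (y \in S); case: (P y).
Qed.

Lemma signed_degreeE x (S : {set T}) :
  signed_degree x S = #|[set y in S | N x y]|%:Z - #|[set y in S | M x y]|%:Z.
Proof. by rewrite /signed_degree sumrB !card_sum. Qed.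

Lemma signed_degree_setT x (S : {set T}) :
  signed_degree x [set: T] = signed_degree x S + signed_degree x (~: S).
Proof.
rewrite /signed_degree (bigID (mem S)) /=; congr (_ + _); apply: eq_bigl => y.
  by rewrite inE.
by rewrite !inE.
Qed.

Lemma signed_degreeU1 x y (S : {set T}) :
  y \notin S -> signed_degree x (y |: S) = edge_sign x y + signed_degree x S.
Proof. by move=> yS; rewrite /signed_degree big_setU1. Qed.

Lemma signed_cut0 : signed_cut set0 = 0.
Proof. by rewrite /signed_cut big_set0. Qed.

(** The edges from [x] to [S] leave the boundary, and the other edges at [x] enter it. *)
Lemma signed_cutU1 x (S : {set T}) :
  x \notin S -> signed_cut (x |: S) =
    signed_cut S + signed_degree x [set: T] - signed_degree x S *+ 2.
Proof.
move=> xS; have xC : x \in ~: S by rewrite inE.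
have CE : ~: S = x |: ~: (x |: S).
  by apply/setP=> y; rewrite !inE; case: eqVneq => [->|].
have E y : signed_degree y (~: S) = edge_sign y x + signed_degree y (~: (x |: S)).
  by rewrite {1}CE signed_degreeU1 // !inE eqxx.
rewrite /signed_cut big_setU1 //= (signed_degree_setT x S) E edge_signxx add0r.
rewrite [X in _ = X + _ - _](eq_bigr _ (fun y _ => E y)) big_split /=.
have -> : \sum_(i in S) edge_sign i x = signed_degree x S.
  by apply: eq_bigr => y _; exact: edge_sign_sym.
by rewrite mulr2n; lia.
Qed.

Lemma maxcut_signed_cut_ge0 (S : {set T}) : maxcut c -> 0 <= signed_cut S.
Proof.
move=> /(_ (flip c S)) le.
have E x y : (mono (flip c S) x y)%:Z =
    (M x y)%:Z + (if (x \in S) != (y \in S) then edge_sign x y else 0).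
  rewrite /edge_sign /mono /bich /flip.
  by case: (e x y); case: (c x); case: (c y); case: (x \in S); case: (y \in S).
have : (0 : int) <= \sum_x \sum_y (mono (flip c S) x y)%:Z - \sum_x \sum_y (M x y)%:Z.
  have sum2 c' : (\sum_x \sum_y mono c' x y)%N%:Z = \sum_x \sum_y (mono c' x y)%:Z.
    rewrite (big_morph Posz PoszD (erefl _)); apply: eq_bigr => x _.
    by rewrite (big_morph Posz PoszD (erefl _)).
  by rewrite subr_ge0 -!sum2 lez_nat.
rewrite -sumrB; under eq_bigr => x _ do rewrite -sumrB.
under eq_bigr => x _ do under eq_bigr => y _ do rewrite E addrAC subrr add0r.
(* A boundary edge yields two ordered pairs, one starting in [S] and one outside; each half sums to
   the signed cut. *)
rewrite (bigID (mem S)) /=.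
have -> : \sum_(x in S) \sum_y
    (if (x \in S) != (y \in S) then edge_sign x y else 0) = signed_cut S.
  apply: eq_bigr => x xS; rewrite /signed_degree [RHS]big_mkcond; apply: eq_bigr => y _.
  by rewrite !inE xS; case: (y \in S).
have -> : \sum_(x | x \notin S) \sum_y
    (if (x \in S) != (y \in S) then edge_sign x y else 0) = signed_cut S.
  rewrite exchange_big /= [RHS]big_mkcond; apply: eq_bigr => x _.
  rewrite /signed_degree big_mkcond; case: ifP => xS.
    rewrite [RHS]big_mkcond; apply: eq_bigr => y _.
    by rewrite !inE; case: (y \in S) => //=; rewrite edge_sign_sym.
  by rewrite big1 // => y _; case: (y \in S).
lia.
Qed.

End SignedCut.

(** * Tight sets in subcubic graphs *)

Section SubcubicCut.
Variables (T : finType) (e : rel T).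
Hypotheses (e_sym : symmetric e) (e_irr : irreflexive e).
Hypothesis deg3 : forall v, #|[set w | e v w]| <= 3.
Variable c : T -> bool.
Hypothesis cmax : maxcut e c.
Local Notation M := (mono e c).
Local Notation N := (bich e c).
Local Notation F := (signed_cut e c).
Local Notation sg := (signed_degree e c).
Implicit Types (P Q S Z : {set T}) (h : {ffun T -> bool}).

Let Fge0 S : (0 <= F S)%R := maxcut_signed_cut_ge0 e_sym S cmax.
Let Msym := mono_sym e_sym c.
Let Nsym := bich_sym e_sym c.

Lemma monoxx x : M x x = false.
Proof. by rewrite /mono e_irr. Qed.

Lemma bich_edge x y : N x y -> e x y.
Proof. by case/andP. Qed.

Lemma mono_edge x y : M x y -> e x y.
Proof. by case/andP. Qed.

Lemma card_edges x S : #|[set y in S | e x y]| =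
  #|[set y in S | N x y]| + #|[set y in S | M x y]|.
Proof.
rewrite -cardsUI [X in _ = _ + X]eq_card0 ?addn0; last first.
  by move=> y; rewrite !inE /mono /bich; case: (y \in S); case: (e _ _) => //=; case: eqP.
by apply: eq_card => y; rewrite !inE (edge_cases e c); case: (y \in S); case: (M x y); case: (N x y).
Qed.

Lemma signed_cut1 x : F [set x] = sg x [set: T].
Proof.
have := signed_cutU1 e_sym e_irr c (_ : x \notin set0).
rewrite inE setU0 signed_cut0 => /(_ isT) ->.
by rewrite /sg big_set0 mul0rn subr0 add0r.
Qed.

(** The second bound is the boundary inequality for [[set x]]. Together they leave at most one
    monochromatic edge at [x], so M is a matching. *)
Lemma degree_split x :
  #|[set y | N x y]| + #|[set y | M x y]| <= 3 /\
  #|[set y | M x y]| <= #|[set y | N x y]|.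
Proof.
have setTE (Q : pred T) : [set y in [set: T] | Q y] = [set y | Q y].
  by apply/setP=> y; rewrite !inE.
have := card_edges x [set: T]; rewrite !setTE => E; split; first by rewrite -E.
by have := Fge0 [set x]; rewrite signed_cut1 (signed_degreeE e c) !setTE; lia.
Qed.

Lemma mono_unique x y z : M x y -> M x z -> y = z.
Proof.
move=> xy xz; have [d1 d2] := degree_split x.
have le1 : #|[set y | M x y]| <= 1 by lia.
by apply: (card_le1_eqP le1); rewrite inE.
Qed.

Definition cov x := [exists y, M x y].
Definition mate x := odflt x [pick y | M x y].

Lemma mono_cov x y : M x y -> cov x.
Proof. by move=> xy; apply/existsP; exists y. Qed.

Lemma mono_mate x : cov x -> M x (mate x).
Proof.
by case/existsP=> y xy; rewrite /mate; case: pickP => [z //|/(_ y)]; rewrite xy.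
Qed.

Lemma mateE x y : M x y -> mate x = y.
Proof. by move=> xy; apply: mono_unique (mono_mate (mono_cov xy)) xy. Qed.

Lemma cov_mate x : cov x -> cov (mate x).
Proof. by move/mono_mate; rewrite Msym; exact: mono_cov. Qed.

Lemma mateK x : cov x -> mate (mate x) = x.
Proof. by move/mono_mate; rewrite Msym; exact: mateE. Qed.

(** One of at most three edges at [x] counts negatively. *)
Lemma signed_degree_cov x : cov x -> (sg x [set: T] <= 1)%R.
Proof.
case/existsP=> y xy; have := card_edges x [set: T]; rewrite (signed_degreeE e c).
have : 0 < #|[set y in [set: T] | M x y]|.
  by apply/card_gt0P; exists y; rewrite !inE.
have <- : #|[set w | e x w]| = #|[set y in [set: T] | e x y]|.
  by apply: eq_card => w; rewrite !inE.
have := deg3 x; lia.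
Qed.

Lemma signed_degree_le3 x : (sg x [set: T] <= 3)%R.
Proof.
have := card_edges x [set: T]; rewrite (signed_degreeE e c).
have <- : #|[set w | e x w]| = #|[set y in [set: T] | e x y]|.
  by apply: eq_card => w; rewrite !inE.
have := deg3 x; lia.
Qed.

Lemma bich_mate x y : cov x -> N x y -> mate x == y = false.
Proof. by move=> cx; apply: contraTF => /eqP <-; rewrite mono_bichF ?mono_mate. Qed.

(** Adding [x] costs its signed degree, at most 1 or 3, and each bichromatic neighbour in [S] saves
    2; with [mate x] outside, no edge to [S] is negative. Many configurations below are excluded by
    growing a set in this way until its signed cut is negative. *)
Lemma signed_cut_grow S x (s : seq T) (k : int) : (F S <= k)%R ->
    x \notin S -> mate x \notin S -> uniq s ->
    all (fun y => (y \in S) && N x y) s ->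
  (F (x |: S) <= k + (if cov x then 1 else 3) - (size s)%:Z *+ 2)%R.
Proof.
move=> FS xS mx us /allP sS; rewrite (signed_cutU1 e_sym e_irr) //.
have sgx : ((size s)%:Z <= sg x S)%R.
  rewrite (signed_degreeE e c) [X in (_ - X%:Z)%R]eq_card0 ?subr0 ?lez_nat; last first.
    by move=> y; rewrite !inE; apply/andP=> -[yS /mateE xy]; rewrite xy yS in mx.
  rewrite -(card_uniqP us); apply/subset_leq_card/subsetP=> y /sS.
  by rewrite inE.
have := @signed_degree_cov x; have := signed_degree_le3 x; case: (cov x) => a b; last by lia.
by have := b isT; lia.
Qed.

Lemma signed_cut_grow_cov S x (s : seq T) (k k' : int) :
    (k + 1 - (size s)%:Z *+ 2 <= k')%R -> (F S <= k)%R -> cov x ->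
    x \notin S -> mate x \notin S -> uniq s ->
    all (fun y => (y \in S) && N x y) s ->
  (F (x |: S) <= k')%R.
Proof.
move=> kk FS cx xS mx us sS; apply: le_trans kk.
by have := signed_cut_grow FS xS mx us sS; rewrite cx.
Qed.

Lemma signed_cut_grow_uncov S x (s : seq T) (k k' : int) :
    (k + 3 - (size s)%:Z *+ 2 <= k')%R -> (F S <= k)%R -> ~~ cov x ->
    x \notin S -> uniq s -> all (fun y => (y \in S) && N x y) s ->
  (F (x |: S) <= k')%R.
Proof.
move=> kk FS cx xS us sS; apply: le_trans kk.
have := signed_cut_grow FS xS _ us sS; rewrite (negPf cx); apply.
by rewrite /mate; case: pickP => [y /mono_cov|_] //; rewrite (negPf cx).
Qed.

Lemma signed_cut_neg S k : (F S <= k)%R -> (k < 0)%R -> False.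
Proof. by move=> FS k0; have := Fge0 S; rewrite leNgt (le_lt_trans FS k0). Qed.

(** Otherwise the set of [u], [v] and [x] has signed cut at most 1 + 1 + (1 - 4) = -1. *)
Lemma covered_neighbours x u v :
  cov x -> cov u -> cov v -> N x u -> N x v -> u != v -> M u v.
Proof.
move=> cx cu cv xu xv uv; apply: contraT => nuv.
have xu' : x != u by apply: contraTneq xu => ->; rewrite /bich e_irr.
have xv' : x != v by apply: contraTneq xv => ->; rewrite /bich e_irr.
have mE y z : cov y -> ~~ M y z -> mate y != z.
  by move=> cy; apply: contraNneq => <-; exact: mono_mate.
have F1 : (F [set u] <= 1)%R by rewrite signed_cut1 signed_degree_cov.
have F2 : (F (v |: [set u]) <= 2)%R.
  apply: (@signed_cut_grow_cov _ _ [::] 1) => //; rewrite inE; first by rewrite eq_sym.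
  by rewrite mE // Msym.
suff /signed_cut_neg/(_ isT) : (F (x |: (v |: [set u])) <= -1)%R by [].
apply: (@signed_cut_grow_cov _ _ [:: u; v] 2) => //=;
by rewrite ?inE ?negb_or ?xu' ?xv' ?uv ?xu ?xv ?eqxx ?orbT ?bich_mate.
Qed.

Lemma bich_le2 x a b d : cov x -> N x a -> N x b -> N x d ->
  a != b -> d != a -> d != b -> False.
Proof.
move=> cx xa xb xd ab da db.
have [d1 _] := degree_split x.
have : 0 < #|[set y | M x y]| by apply/card_gt0P; exists (mate x); rewrite inE mono_mate.
have : 2 < #|[set y | N x y]|.
  have us : uniq [:: a; b; d] by rewrite /= !inE negb_or ab ![_ == d]eq_sym da db.
  rewrite -[3]/(size [:: a; b; d]) -(card_uniqP us); apply/subset_leq_card/subsetP=> y.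
  by rewrite !inE => /or3P[]/eqP->.
lia.
Qed.

(** * Distance at most two, links and hulls *)

Definition near2 : rel T :=
  fun u v => (u != v) && (e u v || [exists x, e u x && e x v]).
Local Notation K := near2.

Lemma near2_sym : symmetric K.
Proof.
move=> u v; rewrite /near2 eq_sym e_sym; congr (_ && (_ || _)).
by apply: eq_existsb => x; rewrite [LHS]andbC (e_sym x v) (e_sym u x).
Qed.

Definition nbr x S := #|[set y in S | e x y]|.

Definition links P := [set l | ~~ cov l & 1 < nbr l P].
Definition hull P := P :|: links P.

(** The last condition ensures that every pair in [K] is accounted for by an edge inside [P] or by a
    link. *)
Definition admissible P := [/\ {in P, forall u, cov u},
  {in P &, forall u v, ~~ M u v} &
  {in P &, forall u v, K u v -> e u v \/ exists x, [/\ ~~ cov x, e u x & e x v]}].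

Lemma admissibleS P (Q : {set T}) : Q \subset P -> admissible P -> admissible Q.
Proof.
move=> /subsetP QP [Pc PM PK]; split=> [u /QP|u v /QP uP /QP|u v /QP uP /QP vP].
- exact: Pc.
- exact: PM.
exact: PK.
Qed.

Lemma links_disjoint P x : admissible P -> x \in P -> x \notin links P.
Proof. by case=> Pc _ _ /Pc cx; rewrite inE cx. Qed.

Lemma cov_notin_hull P x : cov x -> x \notin P -> x \notin hull P.
Proof. by move=> cx xP; rewrite !inE (negPf xP) cx. Qed.

Lemma hull_no_mono P : admissible P -> {in hull P &, forall u v, ~~ M u v}.
Proof.
move=> [Pc PM PK] u v; rewrite !inE.
move=> /orP[uP|/andP[uc _]] /orP[vP|/andP[vc _]]; first exact: PM.
- by apply: contraNN vc; rewrite Msym; exact: mono_cov.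
- by apply: contraNN uc; exact: mono_cov.
by apply: contraNN uc; exact: mono_cov.
Qed.

(* In twice the signed cut of the hull, a vertex of [P] contributes at most 2, and a
   link with k = 2 or 3 neighbours in [P] at most 6 - 4k = - k (k - 1), where
   k (k - 1) is the number of ordered pairs of vertices of [P] that it brings within
   distance two. *)
Lemma hull_tight P : admissible P -> mindeg2 K P ->
  [/\ F (hull P) = 0%R, {in P, forall v, rdeg K v P = 2},
      {in P &, forall u v, ~~ e u v} & {in links P &, forall u v, ~~ e u v}].
Proof.
move=> adm /forall_inP P2; have [Pc PM PK] := adm.
set L := links P.
have dPL : [disjoint P & L].
  by apply/pred0P=> x /=; apply/andP=> -[xP]; apply/negP/links_disjoint.
have PH x : x \in P -> x \in hull P by rewrite in_setU => ->.
have LH x : x \in L -> x \in hull P by rewrite in_setU => ->; rewrite orbT.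
have sgH x : x \in hull P ->
    sg x (~: hull P) = (sg x [set: T] - (nbr x P)%:Z - (nbr x L)%:Z)%R.
  move=> xH; have := signed_degree_setT e c x (hull P); rewrite (signed_degreeE e c x (hull P)).
  have -> : #|[set y in hull P | M x y]| = 0.
    apply: eq_card0 => y; rewrite in_set; apply/negP=> /andP[yH].
    exact/negP/(hull_no_mono adm xH yH).
  have -> : #|[set y in hull P | N x y]| = nbr x P + nbr x L.
    rewrite /nbr -cardsUI [X in _ = _ + X]eq_card0 ?addn0; last first.
      move=> y; rewrite in_setI 2!in_set; apply/negP=> /andP[/andP[yP _] /andP[]].
      by rewrite (disjointFr dPL yP).
    apply: eq_card => y; rewrite [RHS]in_setU 3!in_set -andb_orl -in_setU -/(hull P).
    apply: andb_id2l => yH.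
    by rewrite (edge_cases e c) (negPf (hull_no_mono adm xH yH)).
  by lia.
have dH (f : T -> int) : (\sum_(x in hull P) f x = \sum_(x in P) f x + \sum_(x in L) f x)%R.
  by rewrite -bigU //; apply: eq_bigl => x; rewrite in_setU.
have FE : (F (hull P) <= \sum_(x in P) (1%N%:Z - (nbr x P)%:Z - (nbr x L)%:Z) +
   \sum_(x in L) (3%N%:Z - (nbr x P)%:Z - (nbr x L)%:Z))%R.
  rewrite /signed_cut dH; apply: lerD; apply: ler_sum => x xP.
    by rewrite sgH ?PH //; have := signed_degree_cov (Pc x xP); lia.
  by rewrite sgH ?LH //; have := signed_degree_le3 x; lia.
have sumC : \sum_(x in P) nbr x L = \sum_(l in L) nbr l P.
  transitivity (\sum_(x in P) \sum_(l in L) e x l).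
    apply: eq_bigr => x _; rewrite /nbr -sum1_card big_mkcond [RHS]big_mkcond.
    by apply: eq_bigr => y _; rewrite in_set; case: (y \in L); case: (e x y).
  rewrite exchange_big; apply: eq_bigr => l _.
  rewrite /nbr -sum1_card big_mkcond [RHS]big_mkcond; apply: eq_bigr => y _.
  by rewrite in_set (e_sym y); case: (y \in P); case: (e _ _).
(* The number of vertices of [P] that [v] reaches through links, with multiplicity. It is summed
   over [P] by double counting. *)
pose b v := \sum_(l in L | e v l) (nbr l P).-1.
have sumb : \sum_(v in P) b v = \sum_(l in L) nbr l P * (nbr l P).-1.
  rewrite (exchange_big_dep (mem L)) /=; last by move=> ? ? _ /andP[].
  apply: eq_bigr => l lL; rewrite sum_nat_const; congr (_ * _).
  by apply: eq_card => v; rewrite in_set unfold_in /= (e_sym l) lL.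
have kdeg v : v \in P -> rdeg K v P <= nbr v P + b v.
  move=> vP; pose Q l := [set u in P | e l u] :\ v.
  have sub : [set u in P | K v u] \subset
      [set u in P | e v u] :|: \bigcup_(l in L | e v l) Q l.
    apply/subsetP=> u; rewrite !inE => /andP[uP Kvu]; rewrite uP /=.
    have [->//|[x [xc vx xu]]] := PK v u vP uP Kvu.
    have vu : u != v by case/andP: Kvu; rewrite eq_sym.
    apply/orP; right; apply/bigcupP; exists x; last first.
      by rewrite !inE vu uP.
    rewrite vx andbT inE xc /=; apply/card_gt1P; exists u, v.
    by rewrite !inE uP vP xu e_sym vx.
  apply: leq_trans (subset_leq_card sub) _.
  apply: leq_trans (leq_card_setU _ _) _; rewrite leq_add2l.
  have le_bigcup (r : seq T) (p : pred T) :
      #|\bigcup_(l <- r | p l) Q l| <= \sum_(l <- r | p l) #|Q l|.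
    elim/big_rec2: _ => [|l m A _ le]; first by rewrite cards0.
    by apply: leq_trans (leq_card_setU _ _) _; rewrite leq_add2l.
  apply: leq_trans (le_bigcup _ _) _; apply: leq_sum => l /andP[lL vl].
  have := cardsD1 v [set u in P | e l u]; rewrite inE vP e_sym vl /= /nbr => ->.
  by [].
have lbd l : l \in L -> nbr l P * (nbr l P).-1 + 6 <= 4 * nbr l P.
  rewrite inE => /andP[_ l2].
  have : nbr l P <= 3.
    apply: leq_trans (deg3 l); apply/subset_leq_card/subsetP=> u.
    by rewrite !inE => /andP[].
  by move: l2; case: (nbr l P) => [|[|[|[|]]]].
have sL : \sum_(l in L) nbr l P * (nbr l P).-1 + #|L| * 6 <= 4 * \sum_(l in L) nbr l P.
  by rewrite -sum_nat_const -big_split big_distrr /=; apply: leq_sum.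
have sP : #|P| * 2 + \sum_(v in P) (rdeg K v P - 2) <=
    \sum_(v in P) nbr v P + \sum_(v in P) b v.
  rewrite -sum_nat_const -!big_split /=; apply: leq_sum => v vP.
  by rewrite subnKC ?P2 // kdeg.
have FN : (F (hull P) + (\sum_(x in P) nbr x P)%N%:Z + (\sum_(x in P) nbr x L)%N%:Z +
    (\sum_(x in L) nbr x P)%N%:Z + (\sum_(x in L) nbr x L)%N%:Z <=
    #|P|%:Z + (#|L| * 3)%N%:Z)%R.
  move: FE; rewrite !sumrB -!(big_morph Posz PoszD (erefl _)) !sum_nat_const.
  move: (\sum_(l in L) nbr l P) (\sum_(x in L) nbr x L) #|L| #|P| (F _).
  move: (\sum_(x in P) nbr x P) (\sum_(x in P) nbr x L).
  by clear=> *; lia.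
(* Twice [FN], combined with [sP], [sL] and [sumC], bounds by 0 a sum with positive coefficients of
   these four quantities, all nonnegative. *)
have [z1 z2 z3 z4] : [/\ F (hull P) = 0%R, \sum_(v in P) (rdeg K v P - 2) = 0,
    \sum_(x in P) nbr x P = 0 & \sum_(x in L) nbr x L = 0].
  have := Fge0 (hull P); move: FN sP sL; rewrite sumC sumb.
  move: (\sum_(v in P) (rdeg K v P - 2)) (\sum_(x in P) nbr x P) => A1 A2.
  move: (\sum_(l in L) nbr l P * (nbr l P).-1) => A3.
  move: (\sum_(l in L) nbr l P) (\sum_(x in L) nbr x L) #|L| #|P| (F _) => A4 A5 A6 A7 A8.
  by clear=> *; split; lia.
split=> // [v vP|u v uP vP|u v uL vL].
- move/eqP: z2; rewrite sum_nat_eq0 => /forallP/(_ v); rewrite vP /= subn_eq0.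
  by move=> le; apply/eqP; rewrite eqn_leq le P2.
- move/eqP: z3; rewrite sum_nat_eq0 => /forallP/(_ u); rewrite uP /= /nbr cards_eq0.
  by move=> /eqP/setP/(_ v); rewrite !inE vP /= => ->.
move/eqP: z4; rewrite sum_nat_eq0 => /forallP/(_ u); rewrite uL /= /nbr cards_eq0.
by move=> /eqP/setP/(_ v); rewrite in_set in_set0 vL /= => ->.
Qed.

(** * Choosing an end of every monochromatic edge *)

(** The exceptional triangles: equal choices along both edges at [p] would force [h q = h (mate q)],
    although mates get opposite values. Hence [eff] omits these edges, and [removed] avoids the mate
    of an apex. *)
Definition apex p := cov p && [exists q,
  [&& cov q, N p q, N p (mate q), ~~ e (mate p) q & ~~ e (mate p) (mate q)]].

(* [eff] is a matching, and constant choices on it and alternating choices on M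
   create no pair of chosen vertices joined by a path of length two through a
   covered vertex, unless they are adjacent or an apex interferes. The last
   conjunct discards the triangles, where the constraint would not be a matching,
   but keeps two disjoint edges of the diamond spanned by two edges of M that are
   joined by three edges. *)
Definition eff r x := [&& cov r, cov x, N r x &
  if e r (mate x) then ~~ e x (mate r) && e (mate r) (mate x)
  else e x (mate r) ==> e (mate r) (mate x)].

Lemma eff_sym : symmetric eff.
Proof.
move=> r x; rewrite /eff andbCA Nsym (e_sym (mate r)).
by case: (e r (mate x)); case: (e x (mate r)); case: (e (mate x) (mate r)).
Qed.

(** Two partners would be mates, forming a triangle with [x]. The clause for [r] then demands an
    edge between [mate x] and [s], which the clause for [s] forbids. *)
Lemma eff_unique x r s : eff x r -> eff x s -> r = s.
Proof.
move=> /and4P[cx cr xr er] /and4P[_ cs xs es]; apply/eqP; apply: contraT => rs.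
have Mrs := covered_neighbours cx cr cs xr xs rs.
move: er es; rewrite (mateE Mrs) (mateE (etrans (Msym s r) Mrs)).
rewrite (bich_edge xr) (bich_edge xs) /=.
by rewrite !(e_sym (mate x)); case: (e r (mate x)); case: (e s (mate x)).
Qed.

Definition valid h := [forall x, forall y,
  (M x y ==> (h x != h y)) && (eff x y ==> (h x == h y))].

Lemma validP h : reflect ((forall x y, M x y -> h x = ~~ h y) /\
  (forall x y, eff x y -> h x = h y)) (valid h).
Proof.
apply: (iffP forallP) => [hP|[hM he] x].
  split=> x y xy; have /forallP/(_ y)/andP[] := hP x; rewrite xy /=.
    by case: (h x); case: (h y).
  by move=> _ /eqP.
apply/forallP=> y; apply/andP; split; apply/implyP=> xy; last by rewrite (he x y).
by rewrite (hM x y xy); case: (h y).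
Qed.

Lemma valid_exists : exists h, valid h.
Proof.
pose n x := odflt x [pick y | eff x y].
have nE x : n x != x -> eff x (n x).
  by rewrite /n; case: pickP => [y|_]; rewrite //= eqxx.
have n_eff x y : eff x y -> n x = y.
  by move=> xy; rewrite /n; case: pickP => [z /eff_unique/(_ xy)//|/(_ y)]; rewrite xy.
have [|x xA nA|g [gm gn]] := @two_matchings_bipartite _ [set x | cov x] mate n.
- move=> x; rewrite !inE => cx; rewrite cov_mate // mateK //; split=> //.
  by apply/eqP=> E; have := mono_mate cx; rewrite E monoxx.
- have [E|/nE] := eqVneq (n x) x; first by rewrite !E.
  by rewrite eff_sym => /n_eff.
(* Along an edge of M only [g] changes; along an edge of [eff] both [g] and [c] change. *)
exists [ffun x => g x == c x]; apply/validP; split=> x y xy; rewrite !ffunE.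
  have := gm x; rewrite inE (mateE xy) => /(_ (mono_cov xy)).
  by case/andP: xy => _ /eqP->; case: (g x); case: (g y); case: (c y).
have [cx cy Nxy _] := and4P xy; have := gn x; rewrite !inE (n_eff x y xy) cx cy.
have yx : y != x by apply: contraTneq Nxy => ->; rewrite /bich e_irr.
move=> /(_ isT isT yx); case/andP: Nxy => _.
by case: (g x); case: (g y); case: (c x); case: (c y).
Qed.

(* When the mate of the vertex selected by [h] is an apex, that apex goes to the
   last colour class in place of the selected vertex. *)
Definition removed h := [set v | [&& cov v, h v & ~~ apex (mate v)]].
Definition special h := [set v | [&& cov v, ~~ h v & apex v]].

(** The 2-core of the relation [K] on the removed vertices. *)
Definition core h := \bigcup_(P : {set T} | (P \subset removed h) && mindeg2 K P) P.

Lemma core_sub h : core h \subset removed h.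
Proof. by apply/bigcupsP=> P /andP[]. Qed.

Lemma core_mindeg2 h : mindeg2 K (core h).
Proof. by apply: mindeg2_bigcup => P /andP[]. Qed.

Lemma core_max h P : P \subset removed h -> mindeg2 K P -> P \subset core h.
Proof. by move=> PR P2; apply: bigcup_sup; rewrite PR. Qed.

Section Valid.
Variable h : {ffun T -> bool}.
Hypothesis hV : valid h.
Local Notation R := (removed h).

Let hM x y : M x y -> h x = ~~ h y.
Proof. by have [H _] := validP h hV; exact: H. Qed.

Let he x y : eff x y -> h x = h y.
Proof. by have [_ H] := validP h hV; exact: H. Qed.

Lemma removed_cov v : v \in R -> cov v.
Proof. by rewrite inE => /and3P[]. Qed.

Lemma mate_removed v : v \in R -> mate v \notin R.
Proof.
by rewrite !inE => /and3P[cv hv _]; rewrite -(negbK (h _)) -(hM (mono_mate cv)) hv andbF.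
Qed.

(** As [h] differs on [r] and [x], [eff r x] fails. If [r] and [mate x] were not adjacent, this
    failure would make [x] an apex, and [mate x] would not be removed. *)
Lemma removed_triangle r x :
  r \in R -> cov x -> x \notin R -> mate x \in R -> N r x -> e r (mate x).
Proof.
rewrite !inE => /and3P[cr hr ar] cx xR /and3P[_ hx]; rewrite mateK // => ax rx.
apply: contraT => rx'; have hxF : h x = false by rewrite (hM (mono_mate cx)) hx.
have : ~~ eff r x by apply/negP=> /he; rewrite hr hxF.
rewrite /eff cr cx rx (negPf rx') /= negb_imply => /andP[xr' rx2].
case/negP: ax; rewrite /apex cx; apply/existsP; exists r.
rewrite cr Nsym rx e_sym rx' (e_sym _ (mate r)) rx2 !andbT /= /bich xr'.
case/andP: rx => _; have /andP[_ /eqP->] := mono_mate cr.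
by rewrite eq_sym.
Qed.

(** For a covered middle vertex [x]: two edges of M at [x] are impossible, one leads to
    [removed_triangle], and none to [covered_neighbours]. *)
Lemma removed_admissible : admissible R.
Proof.
split=> [v|u v uR vR|u v uR vR]; first exact: removed_cov.
  by apply/negP=> uv; have := mate_removed uR; rewrite (mateE uv) vR.
case/andP=> uv /orP[|/existsP[x /andP[ux xv]]]; first by left.
have [cx|] := boolP (cov x); last by right; exists x.
left; move: ux; rewrite (edge_cases e c) => /orP[ux|ux].
  have xE := mateE ux; move: xv; rewrite (edge_cases e c) => /orP[xv|xv].
    by case/eqP: uv; apply: mono_unique xv; rewrite Msym.
  have uE : mate x = u by rewrite -xE mateK ?removed_cov.
  rewrite e_sym -uE; apply: removed_triangle; rewrite ?uE 1?Nsym //.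
  by rewrite -xE mate_removed.
move: xv; rewrite (edge_cases e c) => /orP[xv|xv].
  have xE : mate v = x by apply: mateE; rewrite Msym.
  have vE : mate x = v by rewrite -xE mateK ?removed_cov.
  rewrite -vE; apply: removed_triangle; rewrite ?vE //.
  by rewrite -xE mate_removed.
apply: mono_edge; apply: (covered_neighbours cx); rewrite ?removed_cov //.
by rewrite Nsym.
Qed.

Section MinDegTwo.
Variable P : {set T}.
Hypotheses (PR : P \subset R) (P2 : mindeg2 K P).

Let adm := admissibleS PR removed_admissible.

Lemma hull_signed_cut : (F (hull P) <= 0)%R.
Proof. by have [->] := hull_tight adm P2. Qed.

Lemma mindeg2_eq v : v \in P -> rdeg K v P = 2.
Proof. by have [_ H _ _] := hull_tight adm P2; exact: H. Qed.

Lemma mindeg2_stable u v : u \in P -> v \in P -> e u v = false.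
Proof. by have [_ _ H _] := hull_tight adm P2 => uP vP; apply/negbTE/H. Qed.

Lemma links_stable u v : u \in links P -> v \in links P -> e u v = false.
Proof. by have [_ _ _ H] := hull_tight adm P2 => uP vP; apply/negbTE/H. Qed.

Lemma hull_sub x : x \in P -> x \in hull P.
Proof. by move=> xP; rewrite inE xP. Qed.

Lemma uncov_hull x : ~~ cov x -> x \in hull P -> x \in links P.
Proof.
move=> cx; rewrite in_setU => /orP[xP|//].
by rewrite (removed_cov (subsetP PR x xP)) in cx.
Qed.

(** The hull has signed cut 0, and adding [x] would change it by at most 1 - 2. *)
Lemma hull_cov_nbr x t :
  cov x -> x \notin P -> mate x \notin P -> t \in hull P -> N x t -> False.
Proof.
move=> cx xP mxP tP xt; suff /signed_cut_neg/(_ isT) : (F (x |: hull P) <= -1)%R by [].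
apply: (@signed_cut_grow_cov _ _ [:: t] 0) => //=; rewrite ?hull_signed_cut ?cov_notin_hull ?cov_mate //.
by rewrite tP xt.
Qed.

Lemma hull_uncov_nbrs x s t : ~~ cov x -> x \notin hull P ->
  s \in hull P -> t \in hull P -> N x s -> N x t -> s = t.
Proof.
move=> cx xP sP tP xs xt; apply/eqP; apply: contraT => st.
suff /signed_cut_neg/(_ isT) : (F (x |: hull P) <= -1)%R by [].
apply: (@signed_cut_grow_uncov _ _ [:: s; t] 0) => //=; rewrite ?hull_signed_cut //.
  by rewrite mem_seq1 st.
by rewrite sP tP xs xt.
Qed.

(** If [x] is covered, [hull_cov_nbr] puts its mate into [P]; then [removed_triangle] gives an edge
    inside the stable set [P]. *)
Lemma mindeg2_nbr_uncov t x : t \in P -> N t x -> ~~ cov x.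
Proof.
move=> tP tx; apply/negP=> cx; have tR := subsetP PR t tP.
have xP : x \notin P.
  by apply/negP=> xP; move/bich_edge: tx; rewrite mindeg2_stable.
have [mxP|mxP] := boolP (mate x \in P); last first.
  by apply: (hull_cov_nbr cx xP mxP (hull_sub tP)); rewrite Nsym.
have mxR := subsetP PR _ mxP.
have xR : x \notin R by rewrite -(mateK cx) mate_removed.
by have := removed_triangle tR cx xR mxR tx; rewrite mindeg2_stable.
Qed.

End MinDegTwo.
End Valid.

(** * A minimal choice and its exchanges *)

Definition minimal h := valid h /\ forall h', valid h' ->
  #|special h| <= #|special h'| /\
  (#|special h'| <= #|special h| -> #|core h| <= #|core h'|).

Lemma minimal_exists : exists h, minimal h.
Proof.
have [h0 h0V] := valid_exists.
(* The lexicographic order as a single number: a core has at most [#|T|] vertices. *)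
pose w h := #|special h| * #|T|.+1 + #|core h|.
have [h hV hmin] := arg_minnP w h0V; exists h; split=> // h' h'V.
have := hmin h' h'V; rewrite /w.
have := max_card (mem (core h)); have := max_card (mem (core h')).
move: #|special h| #|special h'| #|core h| #|core h'| #|T| => a a' b b' n.
by clear; nia.
Qed.

Definition swap h Z : {ffun T -> bool} := [ffun x => h x (+) (x \in Z)].

(** Unions of connected components of the constraint graph, so that reversing [h] on [Z] respects
    every constraint. *)
Definition swappable Z :=
  forall x y, x \in Z -> M x y || eff x y -> y \in Z.

Lemma swap_valid h Z : swappable Z -> valid h -> valid (swap h Z).
Proof.
move=> Zc /validP[hM he]; have ZE x y : M x y || eff x y -> (x \in Z) = (y \in Z).
  move=> xy; apply/idP/idP=> [xZ|yZ]; first exact: Zc xy.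
  by apply: Zc yZ _; rewrite Msym eff_sym.
apply/validP; split=> x y xy; rewrite !ffunE.
  by rewrite (hM x y xy) (ZE x y) ?xy // addNb.
by rewrite (he x y xy) (ZE x y) ?xy ?orbT.
Qed.

Lemma swap_removed h Z v :
  v \notin Z -> (v \in removed (swap h Z)) = (v \in removed h).
Proof. by move=> /negPf vZ; rewrite !inE ffunE vZ addbF. Qed.

Lemma swap_special h Z v :
  v \notin Z -> (v \in special (swap h Z)) = (v \in special h).
Proof. by move=> /negPf vZ; rewrite !inE ffunE vZ addbF. Qed.

Section Minimal.
Variable h : {ffun T -> bool}.
Hypothesis hmin : minimal h.
Local Notation R := (removed h).
Let hV : valid h := hmin.1.

Let hM x y : M x y -> h x = ~~ h y.
Proof. by have [H _] := validP h hV; exact: H. Qed.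

Let he x y : eff x y -> h x = h y.
Proof. by have [_ H] := validP h hV; exact: H. Qed.

Lemma swap_special_minimal Z p : swappable Z -> p \in special h ->
  special (swap h Z) \subset special h -> p \in special (swap h Z).
Proof.
move=> Zc pS sub; have [le _] := hmin.2 _ (swap_valid Zc hV).
by rewrite -(eqP (_ : special h == special (swap h Z))) // eq_sym eqEcard sub.
Qed.

(** A new core disjoint from [Z] would be contained in the old one and miss [t], against
    minimality. *)
Lemma swap_core_minimal Z t : swappable Z -> t \in core h -> t \in Z ->
    special (swap h Z) \subset special h ->
  exists2 z, z \in Z & z \in core (swap h Z).
Proof.
move=> Zc tc tZ sub; have [_ /(_ (subset_leq_card sub)) le] := hmin.2 _ (swap_valid Zc hV).
apply/exists_inP; apply: contraLR le; rewrite negb_exists_in -ltnNge => /forall_inP out.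
have sub2 : core (swap h Z) \subset core h.
  apply: core_max (core_mindeg2 _); apply/subsetP=> v vc.
  have vZ : v \notin Z by apply: contraL vc => /out.
  by rewrite -(swap_removed h vZ); apply: (subsetP (core_sub _)).
apply/proper_card/properP; split=> //; exists t => //.
exact: out.
Qed.

Lemma core_removed t : t \in core h -> t \in R.
Proof. exact: (subsetP (core_sub h)). Qed.

Lemma core_cov t : t \in core h -> cov t.
Proof. by move/core_removed/removed_cov. Qed.

Lemma core_nbr t x : t \in core h -> N t x -> ~~ cov x.
Proof. by apply: (mindeg2_nbr_uncov hV (core_sub h)); apply: core_mindeg2. Qed.

Lemma core_eff t x : t \in core h -> eff t x = false.
Proof. by move=> tc; apply/negP=> /and4P[_ cx /(core_nbr tc)/negP]. Qed.

Lemma core_apex t : t \in core h -> apex t = false.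
Proof.
move=> tc; apply/negP=> /andP[_ /existsP[q /and5P[cq tq _ _ _]]].
by have := core_nbr tc tq; rewrite cq.
Qed.

Lemma core_mate_apex t : t \in core h -> apex (mate t) = false.
Proof. by move/core_removed; rewrite inE => /and3P[_ _ /negbTE]. Qed.

Lemma core_swap_special Z :
    {in Z, forall z, z \in core h \/ exists2 t, t \in core h & z = mate t} ->
  special (swap h Z) \subset special h.
Proof.
move=> ZE; apply/subsetP=> z; have [/ZE[zc|[t tc ->]]|zZ] := boolP (z \in Z).
- by rewrite inE core_apex ?andbF.
- by rewrite inE core_mate_apex ?andbF.
by rewrite swap_special.
Qed.

(* Otherwise delete the two mates instead of [t] and [u]: a mate in the new core
   would either be adjacent to a core vertex or violate the boundary inequality. *)
Lemma core_mates_nonadjacent t u :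
  t \in core h -> u \in core h -> e (mate t) (mate u) = false.
Proof.
move=> tc uc; apply/negP=> tu.
have [ct cu] := (core_cov tc, core_cov uc).
have [tR uR] := (core_removed tc, core_removed uc).
have tu' : t != u by apply: contraTneq tu => ->; rewrite e_irr.
have Ntu : N (mate t) (mate u).
  move: tu; rewrite (edge_cases e c) => /orP[/mateE|//].
  by rewrite mateK // => tE; have := mate_removed hV uR; rewrite -tE tR.
pose Z := [set t; mate t; u; mate u].
have mate_eff a b y : a \in core h -> b \in core h -> N (mate a) (mate b) ->
    eff (mate a) y -> y = mate b.
  move=> ac bc ab /and4P[ca cy ay _]; apply/eqP; apply: contraT => yb.
  have := covered_neighbours ca cy (cov_mate (core_cov bc)) ay ab yb.
  rewrite Msym => /mateE; rewrite mateK ?core_cov // => yE.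
  by have := core_nbr bc (_ : N b (mate a)); rewrite ca yE Nsym => /(_ ay).
have Zc : swappable Z.
  move=> x y; rewrite !inE -!orbA => /or4P[] /eqP-> /orP[/mateE|].
  - by move=> <-; rewrite eqxx orbT.
  - by rewrite core_eff.
  - by rewrite mateK // => ->; rewrite eqxx.
  - by move=> /(mate_eff t u _ tc uc Ntu)->; rewrite eqxx !orbT.
  - by move=> <-; rewrite eqxx !orbT.
  - by rewrite core_eff.
  - by rewrite mateK // => ->; rewrite eqxx !orbT.
  - by rewrite Nsym in Ntu; move=> /(mate_eff u t _ uc tc Ntu)->; rewrite eqxx !orbT.
have [||z] := swap_core_minimal Zc tc.
- by rewrite !inE eqxx.
- apply: core_swap_special => z; rewrite !inE -!orbA => /or4P[] /eqP->.
  + by left.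
  + by right; exists t.
  + by left.
  by right; exists u.
have h'V := swap_valid Zc hV.
have out a : a \in Z -> a \in core h -> a \notin core (swap h Z).
  move=> aZ ac; have := core_removed ac; rewrite inE => /and3P[_ ha _].
  apply/negP=> /(subsetP (core_sub _)); rewrite inE ffunE ha aZ.
  by rewrite andbF.
have clash a b : N (mate a) (mate b) -> b \in core h -> b \in Z ->
    mate a \in core (swap h Z) -> False.
  move=> ab bc bZ ac'; have P'R := core_sub (swap h Z).
  have P'2 := core_mindeg2 (swap h Z).
  have [bc'|bc'] := boolP (mate b \in core (swap h Z)).
    by have := bich_edge ab; rewrite (mindeg2_stable h'V P'R P'2).
  apply: (hull_cov_nbr h'V P'R P'2 (cov_mate (core_cov bc)) bc' _ (hull_sub ac')).
    by rewrite mateK ?core_cov ?out.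
  by rewrite Nsym.
move=> zZ zc; move: (zZ); rewrite !inE -!orbA => /or4P[] /eqP zE.
- by have := out t; rewrite -zE zZ zc zE tc => /(_ isT isT).
- by apply: (clash t u) => //; rewrite -?zE // !inE eqxx !orbT.
- by have := out u; rewrite -zE zZ zc zE uc => /(_ isT isT).
by apply: (clash u t); rewrite -?zE // ?zE 1?Nsym // !inE eqxx.
Qed.

(* Otherwise delete [mate t] instead of [t]: by minimality [mate t] is in the new
   core, where [u] then has degree at least 3. *)
Lemma core_mate_uncov_nbr P t u y : P \subset R -> mindeg2 K P ->
    t \in core h -> t \notin P -> u \in P -> ~~ cov y ->
  N (mate t) y -> N y u -> False.
Proof.
move=> PR P2 tc tP uP cy ty yu.
have ct := core_cov tc; have cmt := cov_mate ct.
have mtR : mate t \notin R := mate_removed hV (core_removed tc).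
have mtP : mate t \notin P by apply: contra mtR; apply: (subsetP PR).
have uc : u \in core h := subsetP (core_max PR P2) u uP.
have mcov x y' : cov x -> ~~ cov y' -> (x == y') = false.
  by move=> cx; apply: contraNF => /eqP <-.
(* Unless an earlier lemma applies, adding [y], [mate t] and [z] to the hull gives signed cuts at
   most 1, 0 and -1. So [mate t] has no [eff] partner, and [t] can be exchanged with its mate
   alone. *)
have isolated z : cov z -> N (mate t) z -> False.
  move=> cz tz.
  have zP : z \notin P.
    apply/negP=> zP.
    by apply: (hull_cov_nbr hV PR P2 cmt mtP _ (hull_sub zP)); rewrite ?mateK //.
  have mzP : mate z \notin P.
    apply/negP=> mzP; have mzc := subsetP (core_max PR P2) _ mzP.
    by have := core_mates_nonadjacent tc mzc; rewrite mateK // bich_edge.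
  have [yH|yH] := boolP (y \in hull P).
    by apply: (hull_cov_nbr hV PR P2 cmt mtP _ yH); rewrite ?mateK //.
  have F1 : (F (y |: hull P) <= 1)%R.
    apply: (@signed_cut_grow_uncov _ _ [:: u] 0) => //=; first exact: (hull_signed_cut hV PR P2).
    by rewrite hull_sub // yu.
  have mty : mate t \notin y |: hull P.
    by rewrite in_setU1 mcov //= cov_notin_hull.
  have F2 : (F (mate t |: (y |: hull P)) <= 0)%R.
    apply: (@signed_cut_grow_cov _ _ [:: y] 1) => //=; last by rewrite setU11 ty.
    by rewrite mateK // in_setU1 mcov //= cov_notin_hull.
  suff /signed_cut_neg/(_ isT) : (F (z |: (mate t |: (y |: hull P))) <= -1)%R by [].
  apply: (@signed_cut_grow_cov _ _ [:: mate t] 0) => //=.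
  - rewrite !in_setU1 (mcov z y) // (negPf (cov_notin_hull cz zP)) !orbF.
    by apply: contraTneq tz => ->; rewrite /bich e_irr.
  - rewrite !in_setU1 (mcov (mate z) y) ?cov_mate //.
    rewrite (negPf (cov_notin_hull (cov_mate cz) mzP)) !orbF.
    apply: contraTneq tz => mz; rewrite -mz Nsym mono_bichF //.
    exact: mono_mate.
  by rewrite setU11 Nsym tz.
pose Z := [set t; mate t].
have Zc : swappable Z.
  move=> a b; rewrite !inE => /orP[]/eqP-> /orP[/mateE|].
  - by move=> <-; rewrite eqxx orbT.
  - by rewrite core_eff.
  - by rewrite mateK // => ->; rewrite eqxx.
  by case/and4P=> _ cb /(isolated _ cb).
have [||z] := swap_core_minimal Zc tc.
- by rewrite !inE eqxx.
- apply: core_swap_special => z; rewrite !inE => /orP[]/eqP->; first by left.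
  by right; exists t.
have h'V := swap_valid Zc hV.
have out v : v \in core (swap h Z) -> v \in removed (swap h Z).
  exact: (subsetP (core_sub _)).
rewrite !inE => /orP[/eqP->|/eqP-> mtc].
  move/out; have := core_removed tc; rewrite !inE ffunE => /and3P[_ -> _].
  by rewrite !inE eqxx andbF.
have Pc' : P \subset core (swap h Z).
  apply: core_max P2; apply/subsetP=> v vP; rewrite swap_removed ?(subsetP PR) //.
  by rewrite !inE negb_or; apply/andP; split;
    [apply: contraNneq tP|apply: contraNneq mtP] => <-.
have uc' := subsetP Pc' u uP.
have d2 := mindeg2_eq h'V (core_sub _) (core_mindeg2 _) uc'.
have ge2 := forall_inP P2 u uP.
have /subset_leq_card : mate t |: [set v in P | K u v] \subset
    [set v in core (swap h Z) | K u v].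
  apply/subsetP=> v; rewrite !inE => /orP[/eqP->|/andP[vP ->]].
    rewrite mtc /near2 /=; apply/andP; split.
      by apply: contraNneq mtP => <-.
    apply/orP; right; apply/existsP; exists y.
    by rewrite e_sym bich_edge //= e_sym bich_edge.
  by rewrite (subsetP Pc').
rewrite cardsU1 inE (negPf mtP) /= add1n -/(rdeg K u P) -/(rdeg K u _) d2.
by rewrite ltnNge ge2.
Qed.

(** * The cycles of the core and the distances between them *)

Definition component P :=
  minset (fun Q : {set T} => [&& Q \subset R, mindeg2 K Q & Q != set0]) P.

Lemma componentP P : component P -> [/\ P \subset R, mindeg2 K P & P != set0].
Proof. by case/minsetP=> /and3P. Qed.

Lemma component_core P : component P -> P \subset core h.
Proof. by case/componentP=> PR P2 _; apply: core_max. Qed.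

Lemma component_exists Q : Q \subset R -> mindeg2 K Q -> Q != set0 ->
  exists2 P, component P & P \subset Q.
Proof.
move=> QR Q2 Q0.
have [|P Pmin PQ] := @minset_exists _
  (fun Q : {set T} => [&& Q \subset R, mindeg2 K Q & Q != set0]) Q.
  by rewrite QR Q2.
by exists P.
Qed.

(** In the core [v] has exactly two neighbours for [K], and [P] already contains two. *)
Lemma component_closed P v u :
  component P -> v \in P -> u \in core h -> K v u -> u \in P.
Proof.
move=> Pc vP uc vu; have [PR P2 _] := componentP Pc.
have Pcore := component_core Pc.
have d2 := mindeg2_eq hV (core_sub h) (core_mindeg2 h) (subsetP Pcore v vP).
have sub : [set w in P | K v w] \subset [set w in core h | K v w].
  by apply/subsetP=> w; rewrite !inE => /andP[/(subsetP Pcore)-> ->].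
have /eqP/setP/(_ u) : [set w in P | K v w] == [set w in core h | K v w].
  by rewrite eqEcard sub -/(rdeg K v _) -/(rdeg K v _) d2 (forall_inP P2).
by rewrite !inE uc vu andbT.
Qed.

(** By closure the intersection keeps minimum degree two, so minimality applies to both sets. *)
Lemma component_eq P Q v : component P -> component Q -> v \in P -> v \in Q -> P = Q.
Proof.
move=> Pc Qc vP vQ; have [PR P2 P0] := componentP Pc; have [QR _ _] := componentP Qc.
have PQ : [&& P :&: Q \subset R, mindeg2 K (P :&: Q) & P :&: Q != set0].
  rewrite (subset_trans (subsetIl P Q)) //=; apply/andP; split; last first.
    by apply/set0Pn; exists v; rewrite inE vP.
  apply/forall_inP=> u; rewrite inE => /andP[uP uQ].
  apply: leq_trans (forall_inP P2 u uP) _; apply/subset_leq_card/subsetP=> w.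
  rewrite !inE => /andP[wP uw]; rewrite wP uw /= andbT.
  by apply: (component_closed Qc uQ _ uw); apply: (subsetP (component_core Pc)).
have [_ Pmin] := minsetP Pc; have [_ Qmin] := minsetP Qc.
by rewrite -(Pmin _ PQ (subsetIl _ _)) {1}(Qmin _ PQ (subsetIr _ _)).
Qed.

Definition near3 u v := [|| e u v, [exists x, e u x && e x v] |
  [exists x, [exists y, [&& e u x, e x y & e y v]]]].

Lemma near3_sym : symmetric near3.
Proof.
have imp u v : near3 u v -> near3 v u.
  case/or3P=> [uv|/existsP[x /andP[ux xv]]|/existsP[x /existsP[y /and3P[ux xy yv]]]].
  - by rewrite /near3 e_sym uv.
  - apply/or3P; apply: Or32; apply/existsP; exists x.
    by rewrite e_sym xv e_sym.
  apply/or3P; apply: Or33; apply/existsP; exists y; apply/existsP; exists x.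
  by rewrite e_sym yv e_sym xy e_sym.
by move=> u v; apply/idP/idP; apply: imp.
Qed.

Definition contact u v := [exists x, [exists y,
  [&& N u x, N x y, N y v & [&& ~~ cov x, ~~ cov y,
      x \notin hull (core h) & y \notin hull (core h)]]]].

(** On a path [t], [x], [y], [u], the preceding lemmas exclude edges of M at either end. The inner
    vertices are then uncovered; two of them in the hull would be adjacent links, and if just one
    were, the other would have two neighbours in the hull. *)
Lemma component_near3 P Q t u : component P -> component Q -> t \in P -> u \in Q ->
  u \notin P -> near3 t u -> contact t u.
Proof.
move=> Pc Qc tP uQ uP.
have tQ : t \notin Q by apply: contra uP => tQ; rewrite (component_eq Pc Qc tP tQ).
have [PR P2 _] := componentP Pc; have [QR Q2 _] := componentP Qc.
have tc := subsetP (component_core Pc) t tP; have uc := subsetP (component_core Qc) u uQ.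
have [cR c2] := (core_sub h, core_mindeg2 h).
have tu : t != u by apply: contraNneq uP => <-.
case/or3P=> [|txu|/existsP[x /existsP[y /and3P[tx xy yu]]]].
- by rewrite (mindeg2_stable hV cR c2).
- case/negP: uP; apply: (component_closed Pc tP uc).
  by rewrite /near2 tu txu orbT.
move: tx yu; rewrite (edge_cases e c) (edge_cases e c y).
move=> /orP[/mateE xE|tx]; rewrite Msym => /orP[/mateE yE|yu].
- by have := core_mates_nonadjacent tc uc; rewrite xE yE xy.
- have cy : ~~ cov y by apply: (core_nbr uc); rewrite Nsym.
  have [] := core_mate_uncov_nbr QR Q2 tc tQ uQ cy _ yu.
  move: xy; rewrite xE (edge_cases e c) Msym => /orP[/mono_cov|//].
  by rewrite (negPf cy).
- have cx : ~~ cov x by apply: (core_nbr tc).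
  have [] := core_mate_uncov_nbr PR P2 uc uP tP cx; last by rewrite Nsym.
  by move: xy; rewrite yE e_sym (edge_cases e c) Msym => /orP[/mono_cov|//]; rewrite (negPf cx).
have cy : ~~ cov y by apply: (core_nbr uc); rewrite Nsym.
have cx : ~~ cov x by apply: (core_nbr tc).
have Nxy : N x y.
  by move: xy; rewrite (edge_cases e c) => /orP[/mono_cov|//]; rewrite (negPf cx).
have tH := hull_sub tc; have uH := hull_sub uc.
have ndisj a b : ~~ cov a -> b \in core h -> a != b.
  by move=> ca bc; apply: contraNneq ca => ->; apply: core_cov.
have xy' : ~~ ((x \in hull (core h)) && (y \in hull (core h))).
  apply/andP=> -[xH yH]; have := bich_edge Nxy.
  by rewrite (links_stable hV cR c2) // (uncov_hull cR).
have xH : x \notin hull (core h).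
  apply/negP=> xH; rewrite xH /= in xy'.
  have := hull_uncov_nbrs hV cR c2 cy xy' xH uH _ yu; rewrite Nsym => /(_ Nxy) E.
  by have := ndisj x u cx uc; rewrite E eqxx.
have yH : y \notin hull (core h).
  apply/negP=> yH.
  have := hull_uncov_nbrs hV cR c2 cx xH yH tH Nxy _; rewrite Nsym => /(_ tx) E.
  by have := ndisj y t cy tc; rewrite E eqxx.
by apply/existsP; exists x; apply/existsP; exists y; rewrite tx Nxy yu cx cy xH yH.
Qed.

Lemma core_link t : t \in core h -> exists2 l, N t l & l \in links (core h).
Proof.
move=> tc; have [cR c2] := (core_sub h, core_mindeg2 h).
have adm := admissibleS cR (removed_admissible hV).
have /ltnW/card_gt0P[u] := forall_inP c2 t tc.
rewrite inE => /andP[uc tu]; have [_ _ /(_ t u tc uc tu)] := adm.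
rewrite (mindeg2_stable hV cR c2) // => -[//|[l [cl tl lu]]]; exists l.
  by move: tl; rewrite (edge_cases e c) Msym => /orP[/mono_cov|//]; rewrite (negPf cl).
rewrite inE cl; apply/card_gt1P; exists t, u; rewrite !inE tc uc lu e_sym tl.
by split=> //; case/andP: tu.
Qed.

(** One of the at most two bichromatic neighbours of [t] is a link, so [x] is determined. Two
    choices of [y] would give signed cuts at most 1, 0 and -1 when [x], [y], [y'] are added to the
    hull, and [y] determines [u]. *)
Lemma contact_unique t u v : t \in core h -> u \in core h -> v \in core h ->
  contact t u -> contact t v -> u = v.
Proof.
move=> tc uc vc /existsP[x /existsP[y /and4P[tx xy yu /and4P[cx cy xH yH]]]].
case/existsP=> x' /existsP[y' /and4P[tx' xy' yv /and4P[cx' cy' xH' yH']]].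
have [cR c2] := (core_sub h, core_mindeg2 h).
have lH l : l \in links (core h) -> l \in hull (core h) by rewrite !in_setU => ->; rewrite orbT.
have xE : x = x'.
  apply/eqP; apply: contraT => xx'; have [l tl /lH lL] := core_link tc.
  by case: (bich_le2 (core_cov tc) tx tx' tl xx'); [move: xH|move: xH'];
    apply: contraNneq => <-.
subst x'.
have yE : y = y'.
  apply/eqP; apply: contraT => yy'.
  have F1 : (F (x |: hull (core h)) <= 1)%R.
    apply: (@signed_cut_grow_uncov _ _ [:: t] 0) => //=; first exact: (hull_signed_cut hV cR c2).
    by rewrite hull_sub // Nsym tx.
  have neq a b : N a b -> (b == a) = false.
    by apply: contraTF => /eqP->; rewrite /bich e_irr.
  have F2 : (F (y |: (x |: hull (core h))) <= 0)%R.
    apply: (@signed_cut_grow_uncov _ _ [:: x; u] 1) => //=.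
    - by rewrite in_setU1 negb_or neq.
    - by rewrite mem_seq1 andbT; apply: contraNneq cx => ->; rewrite (core_cov uc).
    by rewrite setU11 in_setU (hull_sub uc) orbT Nsym xy yu.
  suff /signed_cut_neg/(_ isT) : (F (y' |: (y |: (x |: hull (core h)))) <= -1)%R by [].
  apply: (@signed_cut_grow_uncov _ _ [:: x; v] 0) => //=.
  - by rewrite !in_setU1 !negb_or (neq x) // eq_sym yy'.
  - by rewrite mem_seq1 andbT; apply: contraNneq cx => ->; rewrite (core_cov vc).
  by rewrite !in_setU1 eqxx !(hull_sub vc) !orbT Nsym xy' yv.
subst y'.
exact: (hull_uncov_nbrs hV cR c2 cy yH (hull_sub uc) (hull_sub vc)).
Qed.

(** * Distances from the special vertices *)

Lemma apex_nbr p x : apex p -> N p x ->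
  [/\ cov x, N p (mate x), e (mate p) x = false & e (mate p) (mate x) = false].
Proof.
case/andP=> cp /existsP[q /and5P[cq pq pmq /negbTE nq /negbTE nmq]] px.
have [->//|xq] := eqVneq x q; have [->|xmq] := eqVneq x (mate q).
  by rewrite mateK ?cov_mate.
case: (bich_le2 cp pq pmq px) => //.
by apply/eqP=> E; have := mono_mate cq; rewrite -E monoxx.
Qed.

Lemma apex_eff p x : apex p -> eff p x = false.
Proof.
move=> ap; apply/negP=> /and4P[_ _ px]; have [_ pmx _ ->] := apex_nbr ap px.
by rewrite (bich_edge pmx) andbF.
Qed.

Lemma special_facts p : p \in special h ->
  [/\ cov p, apex p, h p = false, h (mate p) & (p \notin R) && (mate p \notin R)].
Proof.
rewrite inE => /and3P[cp /negbTE hp ap]; split=> //.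
  by have := hM (mono_mate cp); rewrite hp; case: (h _).
by rewrite !inE hp mateK // ap !andbF.
Qed.

Lemma special_core p u : p \in special h -> u \in core h -> near3 p u = false.
Proof.
move=> pS uc; have [cp ap hp hmp /andP[pR mpR]] := special_facts pS.
have [cR c2] := (core_sub h, core_mindeg2 h); have Mp := mono_mate cp.
have nc x : x \notin R -> x \notin core h by apply/contra/(subsetP cR).
have noN t : t \in hull (core h) -> N p t -> False.
  by apply: (hull_cov_nbr hV cR c2 cp) => //; apply: nc.
have noNm t : t \in hull (core h) -> N (mate p) t -> False.
  by apply: (hull_cov_nbr hV cR c2 (cov_mate cp)); rewrite ?mateK ?nc.
have tp t : t \in core h -> t != p by apply: contraTneq => ->; apply: nc.
have tmp t : t \in core h -> t != mate p by apply: contraTneq => ->; apply: nc.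
have no1 t : t \in core h -> e p t -> False.
  move=> tc; rewrite (edge_cases e c) => /orP[/mateE E|]; last exact/noN/hull_sub.
  by have := tmp t tc; rewrite E eqxx.
have no1m t : t \in core h -> e (mate p) t -> False.
  move=> tc; rewrite (edge_cases e c) => /orP[/mateE E|]; last exact/noNm/hull_sub.
  by have := tp t tc; rewrite -E mateK ?eqxx.
have no2 t x : t \in core h -> e p x -> e x t -> False.
  move=> tc; rewrite (edge_cases e c) => /orP[/mateE<-|px]; first exact: no1m.
  have [cx pmx _ _] := apex_nbr ap px; rewrite (edge_cases e c) => /orP[/mateE E|xt].
    by apply: (no1 t tc); rewrite -E bich_edge.
  rewrite Nsym in px; apply: (no1 t tc); apply: mono_edge.
  by apply: (covered_neighbours cx) => //; rewrite ?core_cov // eq_sym tp.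
(* Such an edge would belong to [eff], but [h] selects [mate p] and not [mate t]. *)
have no2m t : t \in core h -> N (mate p) (mate t) -> False.
  move=> tc pt; have ct := core_cov tc.
  have : eff (mate p) (mate t).
    rewrite /eff !cov_mate // pt !mateK //=.
    case: ifP => [/(no1m t tc)//|_]; apply/implyP.
    rewrite e_sym (edge_cases e c) => /orP[/mateE E|ptm].
      by have := tp t tc; rewrite -(mateK ct) -E mateK ?eqxx.
    by have [_] := apex_nbr ap ptm; rewrite mateK // => /bich_edge/(no1 t tc).
  move/he; rewrite hmp; have := core_removed tc; rewrite inE => /and3P[_ ht _].
  by have := hM (mono_mate ct); rewrite ht => /esym/negbTE->.
(* The boundary inequality leaves [mate p] without covered bichromatic neighbours. So [p] and
   [mate p] can be exchanged, and then neither is special, against minimality. *)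
have no3m t y : t \in core h -> ~~ cov y -> N (mate p) y -> N y t -> False.
  move=> tc cy py yt.
  have yH : y \notin hull (core h) by apply/negP=> /noNm; apply.
  have F1 : (F (y |: hull (core h)) <= 1)%R.
    apply: (@signed_cut_grow_uncov _ _ [:: t] 0) => //=; first exact: (hull_signed_cut hV cR c2).
    by rewrite hull_sub // yt.
  have ycov x : cov x -> (x == y) = false.
    by move=> cx; apply: contraNF cy => /eqP<-.
  have nH x : cov x -> x \notin core h -> x \notin y |: hull (core h).
    by move=> cx xc; rewrite in_setU1 ycov //= cov_notin_hull.
  have F2 : (F (mate p |: (y |: hull (core h))) <= 0)%R.
    apply: (@signed_cut_grow_cov _ _ [:: y] 1) => //=; rewrite ?mateK ?cov_mate //.
    - by rewrite nH ?cov_mate ?nc.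
    - by rewrite nH ?nc.
    by rewrite setU11 py.
  have isolated w : cov w -> N (mate p) w -> False.
    move=> cw pw.
    have wc : w \notin core h by apply/negP=> /hull_sub/noNm; apply.
    have mwc : mate w \notin core h.
      by apply/negP=> mwc; apply: (no2m _ mwc); rewrite mateK.
    suff /signed_cut_neg/(_ isT) : (F (w |: (mate p |: (y |: hull (core h)))) <= -1)%R by [].
    apply: (@signed_cut_grow_cov _ _ [:: mate p] 0) => //=.
    - rewrite in_setU1 negb_or nH // andbT.
      by apply: contraTneq pw => ->; rewrite /bich e_irr.
    - rewrite in_setU1 negb_or nH ?cov_mate // andbT.
      apply: contraTneq pw => E; rewrite -E Nsym mono_bichF //.
      exact: mono_mate.
    by rewrite setU11 Nsym pw.
  pose Z := [set p; mate p].
  have Zc : swappable Z.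
    move=> a b; rewrite !inE => /orP[]/eqP-> /orP[/mateE|].
    - by move=> <-; rewrite eqxx orbT.
    - by rewrite apex_eff.
    - by rewrite mateK // => ->; rewrite eqxx.
    by case/and4P=> _ cb /(isolated _ cb).
  have sub : special (swap h Z) \subset special h.
    apply/subsetP=> z; have [|zZ] := boolP (z \in Z); last by rewrite swap_special.
    rewrite !inE ffunE !inE => /orP[]/eqP->; first by rewrite hp eqxx /= andbF.
    case/and3P=> _ _ /andP[_ /existsP[q /and5P[cq pq _ _ _]]].
    by case: (isolated q).
  have := swap_special_minimal Zc pS sub.
  by rewrite inE ffunE hp !inE eqxx /= andbF.
have uncovN a b : ~~ cov b -> e a b -> N a b.
  by move=> cb; rewrite (edge_cases e c) Msym => /orP[/mono_cov|//]; rewrite (negPf cb).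
apply/negP=> /or3P[/no1|/existsP[x /andP[px xu]]|]; first exact.
  exact: (no2 u x).
case/existsP=> x /existsP[y /and3P[px xy yu]].
have [yp|yp] := eqVneq y p; first by apply: (no1 u uc); rewrite -yp.
move: px; rewrite (edge_cases e c) => /orP[/mateE xE|px].
  have [cy|cy] := boolP (cov y); last first.
    by apply: (no3m u y uc cy); rewrite ?(uncovN _ y) ?xE // Nsym uncovN // e_sym.
  have Npy : N (mate p) y.
    move: xy; rewrite -xE (edge_cases e c) => /orP[/mateE E|//].
    by rewrite -E mateK ?eqxx in yp.
  move: yu; rewrite (edge_cases e c) => /orP[/mateE yE|yu].
    by apply: (no2m u uc); rewrite -yE mateK.
  rewrite Nsym in Npy; apply: (no1m u uc); apply: mono_edge.
  apply: (covered_neighbours cy (cov_mate cp) (core_cov uc) Npy yu).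
  by rewrite eq_sym tmp.
have [cx pmx npx _] := apex_nbr ap px.
move: xy; rewrite (edge_cases e c) => /orP[/mateE xE|xy].
  by apply: (no2 u y) => //; rewrite -xE bich_edge.
have [cy|cy] := boolP (cov y).
  have /mateE E : M p y by apply: (covered_neighbours cx) => //; [rewrite Nsym|rewrite eq_sym].
  by move: npx; rewrite E e_sym bich_edge.
have {}yu : N y u by rewrite Nsym uncovN // e_sym.
have xc : x \notin core h by apply/negP=> /hull_sub/noN; apply.
have mxc : mate x \notin core h by apply/negP=> /hull_sub/noN; apply.
have yH : y \notin hull (core h).
  by apply/negP=> yH; apply: (hull_cov_nbr hV cR c2 cx xc mxc yH xy).
have ycov z : cov z -> (z == y) = false.
  by move=> cz; apply: contraNF cy => /eqP<-.
(* Adding [y], [x] and [p] in turn gives signed cuts at most 1, 0 and -1. *)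
have F1 : (F (y |: hull (core h)) <= 1)%R.
  apply: (@signed_cut_grow_uncov _ _ [:: u] 0) => //=; first exact: (hull_signed_cut hV cR c2).
  by rewrite hull_sub // yu.
have nH z : cov z -> z \notin core h -> z \notin y |: hull (core h).
  by move=> cz zc; rewrite in_setU1 ycov //= cov_notin_hull.
have F2 : (F (x |: (y |: hull (core h))) <= 0)%R.
  apply: (@signed_cut_grow_cov _ _ [:: y] 1) => //=; rewrite ?nH ?cov_mate //.
  by rewrite setU11 xy.
suff /signed_cut_neg/(_ isT) : (F (p |: (x |: (y |: hull (core h)))) <= -1)%R by [].
apply: (@signed_cut_grow_cov _ _ [:: x] 0) => //=.
- rewrite in_setU1 negb_or nH ?nc // andbT.
  by apply: contraTneq px => ->; rewrite /bich e_irr.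
- by rewrite in_setU1 negb_or nH ?cov_mate ?nc // andbT bich_mate.
by rewrite setU11 px.
Qed.

(** A neighbour of an apex is its mate or lies in its triangle. This excludes every short path
    except [p], [mate p], [mate r], [r]. *)
Lemma special_special p r : p \in special h -> r \in special h -> p != r ->
  near3 p r = false.
Proof.
move=> pS rS pr; have [cp ap hp hmp _] := special_facts pS.
have [cr ar hr hmr _] := special_facts rS.
have mneq u v : h u = false -> cov u -> h v = false -> mate u != v.
  by move=> hu cu hv; apply: contraFneq hv => <-; rewrite -(negbK (h _)) -(hM (mono_mate cu)) hu.
have no1 u v : u \in special h -> v \in special h -> e u v -> False.
  move=> uS vS; have [cu au hu _ _] := special_facts uS.
  have [cv av hv _ _] := special_facts vS.
  rewrite (edge_cases e c) => /orP[/mateE E|uv].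
    by have := mneq u v hu cu hv; rewrite E eqxx.
  have [_ _ nuv _] := apex_nbr au uv; rewrite Nsym in uv.
  by have [_ /bich_edge] := apex_nbr av uv; rewrite e_sym nuv.
have no2 u v x : u \in special h -> v \in special h -> u != v -> e u x -> e x v -> False.
  move=> uS vS uv; have [cu au hu _ _] := special_facts uS.
  have [cv av hv _ _] := special_facts vS.
  rewrite (edge_cases e c) => /orP[/mateE<-|ux].
    rewrite (edge_cases e c) => /orP[/mateE E|].
      by rewrite -E mateK // eqxx in uv.
    rewrite Nsym => /(apex_nbr av)[_]; rewrite mateK // => /bich_edge vu _ _.
    exact: no1 vS uS vu.
  have [cx umx _ _] := apex_nbr au ux; rewrite (edge_cases e c) => /orP[/mateE E|xv].
    by apply: (no1 u v) => //; rewrite -E bich_edge.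
  rewrite Nsym in ux; apply: (no1 u v) => //; apply: mono_edge.
  exact: (covered_neighbours cx).
(* Exchanging both pairs at once would make [p] and [r] nonspecial, and their mates are not
   apexes. *)
have matesN : N (mate p) (mate r) -> False.
  move=> mpr; pose Z := [set p; mate p; r; mate r].
  have mate_nbr u v y : u \in special h -> v \in special h -> u != v ->
      N (mate u) (mate v) -> cov y -> N (mate u) y -> y = mate v.
    move=> uS vS uv muv cy uy; apply/eqP; apply: contraT => yv.
    have [cu _ _ _ _] := special_facts uS; have [cv _ _ _ _] := special_facts vS.
    have := covered_neighbours (cov_mate cu) cy (cov_mate cv) uy muv yv.
    rewrite Msym => /mateE; rewrite mateK // => E.
    case: (no2 u v (mate u)) => //; first exact/mono_edge/mono_mate.
    by rewrite E bich_edge.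
  have rp : r != p by rewrite eq_sym.
  have mrp : N (mate r) (mate p) by rewrite Nsym.
  have Zc : swappable Z.
    move=> x y; rewrite !inE -!orbA => /or4P[] /eqP-> /orP[/mateE|].
    - by move=> <-; rewrite eqxx orbT.
    - by rewrite apex_eff.
    - by rewrite mateK // => ->; rewrite eqxx.
    - by case/and4P=> _ cy /(mate_nbr p r _ pS rS pr mpr cy)->; rewrite eqxx !orbT.
    - by move=> <-; rewrite eqxx !orbT.
    - by rewrite apex_eff.
    - by rewrite mateK // => ->; rewrite eqxx !orbT.
    - by case/and4P=> _ cy /(mate_nbr r p _ rS pS rp mrp cy)->; rewrite eqxx !orbT.
  have mapex u v : u \in special h -> v \in special h -> u != v ->
      N (mate u) (mate v) -> apex (mate u) = false.
    move=> uS vS uv muv; apply/negP=> au; have [cv _ _ _ _] := special_facts vS.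
    have [_] := apex_nbr au muv; rewrite mateK // => /bich_edge umv _ _.
    have [cu _ _ _ _] := special_facts uS.
    by apply: (no2 u v (mate u)) => //; apply/mono_edge/mono_mate.
  have sub : special (swap h Z) \subset special h.
    apply/subsetP=> z; have [|zZ] := boolP (z \in Z); last by rewrite swap_special.
    rewrite !inE ffunE !inE -!orbA => /or4P[]/eqP->.
    - by rewrite hp eqxx /= andbF.
    - by rewrite (mapex p r) // !andbF.
    - by rewrite hr eqxx !orbT /= andbF.
    - by rewrite (mapex r p) // !andbF.
  have := swap_special_minimal Zc pS sub.
  by rewrite inE ffunE hp !inE eqxx /= andbF.
apply/negP=> /or3P[/(no1 _ _ pS rS)//|/existsP[x /andP[px xr]]|].
  exact: (no2 p r x).
case/existsP=> x /existsP[y /and3P[px xy yr]].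
have [yp|yp] := eqVneq y p; first by apply: (no1 p r) => //; rewrite -yp.
move: px; rewrite (edge_cases e c) => /orP[/mateE xE|px].
  move: xy; rewrite -xE (edge_cases e c) => /orP[/mateE E|py].
    by rewrite -E mateK ?eqxx in yp.
  move: yr; rewrite (edge_cases e c) Msym => /orP[/mateE yE|yr].
    by apply: matesN; rewrite yE.
  rewrite Nsym in yr; have [cy _ _ _] := apex_nbr ar yr.
  rewrite Nsym in py; rewrite Nsym in yr.
  have /mateE : M (mate p) r.
    by apply: (covered_neighbours cy) => //; rewrite ?cov_mate // mneq.
  by move/eqP: pr; rewrite mateK.
have [cx pmx npx _] := apex_nbr ap px.
move: xy; rewrite (edge_cases e c) => /orP[/mateE xE|xy].
  by apply: (no2 p r y) => //; rewrite -xE bich_edge.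
have cy : cov y.
  move: yr; rewrite (edge_cases e c) => /orP[/mono_cov//|].
  by rewrite Nsym => /(apex_nbr ar)[].
have /mateE E : M p y by apply: (covered_neighbours cx) => //; [rewrite Nsym|rewrite eq_sym].
by move: npx; rewrite E e_sym bich_edge.
Qed.

(** * Assembling the five colour classes *)

Lemma component_transversal : exists X : {set T}, [/\ X \subset core h,
  {in X &, forall u v, u != v -> ~~ near3 u v} &
  forall P, component P -> exists2 t, t \in X & t \in P].
Proof.
pose ct u v := [exists P, [exists Q,
  [&& component P, component Q, u \in P, v \in Q, P != Q & near3 u v]]].
have ctP u v : ct u v -> [/\ u \in core h, v \in core h & contact u v].
  case/existsP=> P /existsP[Q /and5P[Pc Qc uP vQ /andP[PQ uv]]].
  rewrite (subsetP (component_core Pc) _ uP) (subsetP (component_core Qc) _ vQ).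
  split=> //; apply: (component_near3 Pc Qc) => //; apply: contra PQ => vP.
  by apply/eqP; apply: component_eq vP vQ.
have ct_sym : symmetric ct.
  suff imp u v : ct u v -> ct v u by move=> u v; apply/idP/idP; apply: imp.
  case/existsP=> P /existsP[Q /and5P[Pc Qc uP vQ /andP[PQ uv]]].
  apply/existsP; exists Q; apply/existsP; exists P.
  by rewrite Pc Qc uP vQ eq_sym PQ near3_sym.
(* Each vertex has at most one conflict by [contact_unique], and no component has fewer than two
   vertices. *)
have [|||||X [XB BX X1 Xct]] :=
    @independent_transversal _ ct _ [set P | component P] id ct_sym.
- move=> u; apply/negbTE/negP=> /existsP[P /existsP[Q /and5P[Pc Qc uP uQ /andP[PQ _]]]].
  by rewrite (component_eq Pc Qc uP uQ) eqxx in PQ.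
- move=> s t u /ctP[sc tc st] /ctP[_ uc su]; exact: (contact_unique sc tc uc).
- by move=> P; rewrite inE => /componentP[].
- move=> P Q; rewrite inE => /componentP[_ P2 /set0Pn[t tP]] _ P1 _.
  have le : rdeg K t P <= #|P|.
    by apply/subset_leq_card/subsetP=> u; rewrite inE => /andP[].
  by have := leq_trans (forall_inP P2 t tP) (leq_trans le P1).
- move=> P Q; rewrite !inE => Pc Qc t; exact: component_eq.
have XP t : t \in X -> exists2 P, component P & t \in P.
  by move=> /XB[P]; rewrite inE; exists P.
exists X; split=> [|u v uX vX uv|P Pc].
- by apply/subsetP=> t /XP[P /component_core/subsetP]; apply.
- have [P Pc uP] := XP u uX; have [Q Qc vQ] := XP v vX.
  have := Xct u v uX vX; apply: contra => uv3; apply/existsP; exists P; apply/existsP; exists Q.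
  rewrite Pc Qc uP vQ uv3 andbT /=; apply: contra uv => /eqP PQ; apply/eqP.
  by apply: (X1 P) => //; rewrite ?inE // PQ.
by apply: BX; rewrite inE.
Qed.

(** Colours 0 and 1 are the sides of the cut, 2 and 3 come from the forest, and 4 is given to the
    special vertices and the transversal. *)
Lemma minimal_packing : exists col : T -> nat, (forall v, col v < 5) /\
  forall u v, u != v -> col u = col v ->
    [/\ ~~ e u v, 1 < col u -> ~~ near2 u v & col u = 4 -> ~~ near3 u v].
Proof.
have [X [Xcore X3 XP]] := component_transversal.
(* Any nonempty set of minimum degree two contains a component, hence a vertex of [X]. *)
have [|g gP] := @forest_two_colorable _ near2 (R :\: X) near2_sym.
  move=> P PR P2; apply/eqP; apply: contraT => P0.
  have [Q Qc QP] := component_exists (subset_trans PR (subsetDl _ _)) P2 P0.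
  have [t tX /(subsetP QP)/(subsetP PR)] := XP Q Qc.
  by rewrite inE tX.
pose X4 : {pred T} := [predU special h & X].
have X4_near3 u v : u \in X4 -> v \in X4 -> u != v -> ~~ near3 u v.
  move=> /orP[us|uX] /orP[vs|vX] uv.
  - by rewrite special_special.
  - by rewrite special_core // (subsetP Xcore).
  - by rewrite near3_sym special_core // (subsetP Xcore).
  exact: X3.
have near23 u v : near2 u v -> near3 u v.
  by case/andP=> _ /orP[uv|uv]; rewrite /near3 uv ?orbT.
pose col v : nat := if v \in X4 then 4 else if v \in R then (g v).+2 else c v.
exists col; split=> [v|u v uv].
  by rewrite /col; case: ifP => // _; case: ifP => _; [case: (g v)|case: (c v)].
rewrite /col; case: (boolP (u \in X4)) => u4; case: (boolP (v \in X4)) => v4.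
- move=> _; have n3 := X4_near3 u v u4 v4 uv; split=> // [|_].
    by apply: contra n3 => E; rewrite /near3 E.
  by apply: contra n3; apply: near23.
- by case: ifP => _; [case: (g v)|case: (c v)].
- by case: ifP => _; [case: (g u)|case: (c u)].
case: (boolP (u \in R)) => uR; case: (boolP (v \in R)) => vR.
- case=> guv; have n2 : ~~ near2 u v.
    move/norP: u4 => [_ uX]; move/norP: v4 => [_ vX].
    apply/negP=> n2; have := gP u v _ _ uv n2; rewrite !in_setD uX vX uR vR.
    by move=> /(_ isT isT); case: (g u) guv; case: (g v).
  split=> //; last by case: (g u).
  by apply: contra n2; rewrite /near2 uv => ->.
- by case: (g u); case: (c v).
- by case: (g v); case: (c u).
move=> cuv; split; [|by case: (c u)..].
(* On an edge of M, the end selected by [h] is removed or else its mate is a special apex. *)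
apply/negP=> e_uv; have Muv : M u v.
  by rewrite /mono e_uv; move: cuv; case: (c u); case: (c v).
have [cu cv] : cov u /\ cov v by split; [|rewrite Msym in Muv]; apply: mono_cov Muv.
have mE := mateE Muv; have mE' : mate v = u by rewrite -mE mateK.
move/norP: u4 => [us _]; move/norP: v4 => [vs _].
have := hM Muv; move: us vs uR vR; rewrite /= !inE cu cv mE mE' /=.
by case: (h u); case: (h v) => //=; case: (apex u); case: (apex v).
Qed.

End Minimal.

End SubcubicCut.

(** In other words, a packing (1,1,2,2,3)-colouring, with colours numbered from 0. *)
Lemma subcubic_packing (T : finType) (e : rel T) :
    symmetric e -> irreflexive e -> (forall v, #|[set w | e v w]| <= 3) ->
  exists col : T -> nat, (forall v, col v < 5) /\
  forall u v, u != v -> col u = col v ->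
    [/\ ~~ e u v, 1 < col u -> ~~ near2 e u v & col u = 4 -> ~~ near3 e u v].
Proof.
move=> e_sym e_irr deg3; have [c cmax] := maxcut_exists e.
have [h hmin] := minimal_exists e_sym e_irr deg3 cmax.
exact: (minimal_packing e_sym e_irr deg3 cmax hmin).
Qed.

Lemma dist_geP (H : sgraph) (u v : H) k :
  (forall p, path (@adj H) u p -> last u p = v -> k <= size p) -> dist_ge u v k.
Proof.
(* [dist] matches on a specific reflection proof; generalising it permits the case analysis. *)
move=> far; have elim_reflect (P : Prop) b (r : reflect P b) (f : P -> option nat) :
    (forall uv, if f uv is Some d then k <= d else true) ->
    if (if r is ReflectT uv then f uv else None) is Some d then k <= d else true.
  by case: r.
apply: elim_reflect => uv; case: ex_minnP => d /existsP[p /andP[up /eqP pv]] _.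
by have := far p up pv; rewrite size_tuple.
Qed.

(** * Distances in the 1-subdivision *)

Section Subdivision.
Variable G : sgraph.
Implicit Types x y : G.

Lemma edges_adj (E : {set G}) x y : E \in edges G -> x \in E -> y \in E ->
  x != y -> adj x y.
Proof.
case/imsetP=> -[a b]; rewrite inE /= => ab ->; rewrite !inE.
by move=> /orP[]/eqP-> /orP[]/eqP->; rewrite ?eqxx // adj_sym.
Qed.

(** Two steps in the subdivision pass through one edge and may return to the starting vertex. *)
Definition lazy_adj x y := (x == y) || adj x y.

Lemma subdivision_path x y (p : seq (subdivision G)) :
    path (@adj (subdivision G)) (inl x) p -> last (inl x) p = inl y ->
  exists q, [/\ path lazy_adj x q, last x q = y & size p = (size q).*2].
Proof.
have [k] := ubnP (size p); elim: k => // k IH in p x *.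
case: p => [_ _ [<-]|[w|E] [|[z|E'] p]] //=; first by exists [::].
  2: by rewrite andbF.
rewrite !ltnS => le /and3P[xE zE zp] lp.
have [q [zq lq sq]] := IH p z (ltnW le) zp lp.
exists (z :: q); split=> //=; last by rewrite sq.
rewrite zq andbT /lazy_adj; case: eqVneq => //= xz.
exact: edges_adj (valP E) xE zE xz.
Qed.

Lemma lazy_path_near x y (q : seq G) : path lazy_adj x q -> last x q = y -> x != y ->
  [/\ size q <= 1 -> adj x y, size q <= 2 -> near2 (@adj G) x y &
      size q <= 3 -> near3 (@adj G) x y].
Proof.
move=> xq lq xy; have n12 : adj x y -> near2 (@adj G) x y.
  by move=> a; rewrite /near2 xy a.
have n13 : adj x y -> near3 (@adj G) x y by move=> a; rewrite /near3 a.
have n22 a : adj x a -> adj a y -> near2 (@adj G) x y.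
  move=> xa ay; rewrite /near2 xy; apply/orP; right; apply/existsP; exists a.
  by rewrite xa.
have n23 a : adj x a -> adj a y -> near3 (@adj G) x y.
  move=> xa ay; apply/or3P; apply: Or32; apply/existsP; exists a.
  by rewrite xa.
have n33 a b : adj x a -> adj a b -> adj b y -> near3 (@adj G) x y.
  move=> xa ab b_y; apply/or3P; apply: Or33; apply/existsP; exists a.
  by apply/existsP; exists b; rewrite xa ab.
case: q xq lq => [|a [|b [|d [|f q]]]] //=.
- by move=> _ xE; rewrite xE eqxx in xy.
- by rewrite andbT => /orP[/eqP xa|xa] aE; subst; [rewrite eqxx in xy|split; auto].
- rewrite andbT => /andP[/orP[/eqP xa|xa] /orP[/eqP ab|ab]] bE; subst.
  + by rewrite eqxx in xy.
  + by split; auto.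
  + by split; auto.
  + by split=> // _; [apply: n22 xa ab|apply: n23 xa ab].
rewrite andbT => /and3P[/orP[/eqP xa|xa] /orP[/eqP ab|ab] /orP[/eqP bd|bd]] dE;
  subst; split=> // _; try by [apply: n13|apply: n23 ab bd|apply: n23 xa bd|
  apply: n23 xa ab|apply: n33 xa ab bd].
by rewrite eqxx in xy.
Qed.

End Subdivision.

Theorem corollary1p3 (G : sgraph) (hG : subcubic G) :
  packing_chromatic_number (subdivision G) <= 6.
Proof.
have deg3 v : #|[set w | @adj G v w]| <= 3.
  exact: leq_trans (leq_bigmax v) hG.
have [col [col5 colP]] := subcubic_packing (@adj_sym G) (@adj_irr G) deg3.
rewrite /packing_chromatic_number; case: ex_minnP => m _; apply.
(* Colour 0 is kept for the subdivision vertices, which shifts the others by one. *)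
pose c (a : subdivision G) : 'I_6 := if a is inl v then inord (col v).+1 else ord0.
have cE v : c (inl v) = (col v).+1 :> nat by rewrite /= inordK // ltnS col5.
apply/existsP; exists [ffun a => c a].
apply/forallP=> a; apply/forallP=> b; apply/implyP=> ab.
rewrite !ffunE; apply/implyP=> /eqP cab; rewrite tnth_mktuple.
apply: dist_geP => p ap pb.
case: a b => [x|E] [y|E'] in ab cab ap pb *.
- have xy : x != y by apply: contra_neq ab => ->.
  have colE : col x = col y by apply: succn_inj; rewrite -!cE cab.
  have [n1 n2 n3] := colP x y xy colE.
  have [q [xq qy ->]] := subdivision_path ap pb.
  have [q1 q2 q3] := lazy_path_near xq qy xy; rewrite cE.
  have := col5 x; have s1 : 1 < size q by rewrite ltnNge; apply: contra n1.
  have s2 : 1 < col x -> 2 < size q.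
    by move=> /n2 n; rewrite ltnNge; apply: contra n.
  have s3 : col x = 4 -> 3 < size q.
    by move=> /n3 n; rewrite ltnNge; apply: contra n.
  (* The required distances 3, 4, 5, 6, 7 follow from the doubled distances 4, 4, 6, 6, 8. *)
  case: (col x) s2 s3 => [|[|[|[|[|k]]]]] // s2 s3 _.
  + by rewrite (leq_trans (_ : _ <= 2.*2)) ?leq_double.
  + by rewrite (leq_trans (_ : _ <= 2.*2)) ?leq_double.
  + by rewrite (leq_trans (_ : _ <= 3.*2)) ?leq_double // s2.
  + by rewrite (leq_trans (_ : _ <= 3.*2)) ?leq_double // s2.
  by rewrite (leq_trans (_ : _ <= 4.*2)) ?leq_double // s3.
- by have := cE x; rewrite cab.
- by have := cE y; rewrite -cab.
(* Two subdivision vertices need distance 2 only, and a single step from one ends at an original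
   vertex. *)
case: p ap pb => [_ /= E0|[z|F] [|d p]] //=.
by rewrite E0 eqxx in ab.
Qed.
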